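(* Let $m\geq 4$ and $0\leq r\leq\left\lfloor\frac{m-3}{2}\right\rfloor$. The number of mod $2$ characteristic matrices over $\mathrm{Bier}\,\Delta_r^{m-1}$ up to D--J equivalence is $$ \begin{cases} 1+m\cdot 2^{m-2}, & \text{if } r=0,\\ 1+m, & \text{if } 0<r\leq\left\lfloor\frac{m-3}{2}\right\rfloor. \end{cases} $$ Moreover, up to D--J equivalence, every such matrix is of the form $\Lambda(\mathcal{A})$ with $\mathcal{A}$ one of the following matrices. When $r=0$: (1) $\mathcal{A}=A_0$; (2) $\mathcal{A}=A_v$ for $v\in\mathbb{Z}_2^{m-2}$; (3) $\mathcal{A}=B_v^1$ for $v\in\mathbb{Z}_2^{m-2}$; (4) $\mathcal{A}=C_v^t$ for $t\in\{r+2,\ldots,m-1\}$ and $v\in\mathbb{Z}_2^{m-2}$. When $0<r\leq\left\lfloor\frac{m-3}{2}\right\rfloor$: (1) $\mathcal{A}=A_0$; (2) $\mathcal{A}=A_v$, where $v=(1,\ldots,1)$; (3) $\mathcal{A}=B_v^s$ for $s\in\{1,\ldots,r+1\}$, where $v=(0,\ldots,0)$; (4) $\mathcal{A}=C_v^t$ for $t\in\{r+2,\ldots,m-1\}$, where $v=(v_{r+2},\ldots,v_{m-1})$ satisfies $v_t=1$ and $v_i=0$ for all $i\neq t$.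
   Context: Notation: $\mathbb{Z}_2=\mathbb{Z}/2$; $[m]=\{1,\ldots,m\}$, $[\overline m]=\{\overline 1,\ldots,\overline m\}$ is a disjoint copy; for $\sigma\subseteq[m]$, $\overline\sigma=\{\overline i\mid i\in\sigma\}$. Bier spheres. For a simplicial complex $K\subsetneq 2^{[m]}$, the Alexander dual is $\widehat K=\{\overline\sigma\subseteq[\overline m]\mid [m]\setminus\sigma\notin K\}$, and $\mathrm{Bier}\,K=\{\sigma\cup\overline\tau\mid \sigma\in K,\ \overline\tau\in\widehat K,\ \sigma\cap\tau=\emptyset\}$, an $(m-2)$-dimensional simplicial sphere. $\Delta_r^{m-1}=\{\sigma\subseteq[m]\mid |\sigma|\leq r+1\}$. Characteristic matrices. A mod $2$ characteristic matrix over $\mathrm{Bier}\,\Delta_r^{m-1}$ is an $(m-1)\times 2m$ matrix over $\mathbb{Z}_2$ with columns indexed by $[m]\cup[\overline m]$ such that for every simplex the columns indexed by its vertices are linearly independent (non-singularity condition). $\Lambda_1,\Lambda_2$ are D--J equivalent if $\Lambda_2=P\Lambda_1$ for some $P\in\mathrm{GL}(m-1,\mathbb{Z}_2)$. For an $(m-1)\times(m+1)$ matrix $\mathcal{A}$ over $\mathbb{Z}_2$, $\Lambda(\mathcal{A})=(I_{m-1}\mid\mathcal{A})$, where the columns of the identity block $I_{m-1}$ are indexed, in order, by $1,\ldots,r+1,\overline{r+2},\ldots,\overline{m-1}$, and the columns of $\mathcal{A}$ are indexed, in order, by $\overline 1,\ldots,\overline{r+1},r+2,\ldots,m-1,m,\overline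 m$. (The set $\{1,\ldots,r+1,\overline{r+2},\ldots,\overline{m-1}\}$ is a facet of $\mathrm{Bier}\,\Delta_r^{m-1}$.) The following $(m-1)\times(m+1)$ matrices over $\mathbb{Z}_2$ are given by entries $(i,j)$ in row position $1\le i\le m-1$ and column position $1\le j\le m+1$ (positions $m$ and $m+1$ are the columns labelled $m$ and $\overline m$). Let $v=(v_{r+2},\ldots,v_{m-1})\in\mathbb{Z}_2^{m-r-2}$, and let $\delta_{ij}$ be the Kronecker delta. - $A_0$: the entry is $\delta_{ij}$ for $j\le m-1$, and $1$ for $j=m,m+1$. - $A_v$: the entry is $1-\delta_{ij}$ for $j\le m-1$; in column $m$ it is $1$ for $i\le r+1$ and $v_i$ for $i\ge r+2$; in column $m+1$ it is $1$. - $B_v^s$ ($s\in\{1,\ldots,r+1\}$): row $s$ has entry $1$ for $j\le m$ and $0$ for $j=m+1$; each row $i\le r+1$ with $i\ne s$ has entry $\delta_{ij}$ for $j\le m-1$ and $1$ for $j=m,m+1$; each row $i\ge r+2$ has entry $v_i+\delta_{ij}$ for $j\le m-1$, entry $v_i+1$ for $j=m$, and entry $1$ for $j=m+1$. - $C_v^t$ ($t\in\{r+2,\ldots,m-1\}$): obtained from $A_0$ by adding the column vector $(1+v_t,\ldots,1+v_t,v_{r+2},\ldots,v_{m-1})^T$ (with $1+v_t$ repeated $r+1$ times) to its $t$th column and adding the row vector $(1,\ldots,1,1,0)\in\mathbb{Z}_2^{m+1}$ (last entry $0$, all others $1$) to its $t$th row. *)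

(* Defs.v *)
From mathcomp Require Import all_boot all_order all_algebra.

Set Implicit Arguments.
Unset Strict Implicit.
Unset Printing Implicit Defensive.

Import GRing.Theory.
Local Open Scope ring_scope.

(** The label [a] of the set {1, ..., m} is the ordinal of value [a - 1];
    [inl a] is the vertex a and [inr a] its barred copy. *)
Notation vertex m := ('I_m + 'I_m)%type (only parsing).

Definition unbarred m (s : {set 'I_m}) : {set vertex m} :=
  [set (inl i : vertex m) | i in s].

Definition barred m (s : {set 'I_m}) : {set vertex m} :=
  [set (inr i : vertex m) | i in s].

Definition alexander_dual m (K : {set {set 'I_m}}) : {set {set vertex m}} :=
  [set barred s | s : {set 'I_m} & ~: s \notin K].

Definition Bier m (K : {set {set 'I_m}}) : {set {set vertex m}} :=
  [set unbarred p.1 :|: barred p.2 | p : {set 'I_m} * {set 'I_m} &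
     [&& p.1 \in K, barred p.2 \in alexander_dual K & [disjoint p.1 & p.2]]].

Definition simplex_skeleton (m r : nat) : {set {set 'I_m}} :=
  [set s : {set 'I_m} | (#|s| <= r.+1)%N].

(** The first [m] columns are indexed by 1, ..., m and the last [m] by their
    barred copies. *)
Definition vcol m (L : 'M['F_2]_(m.-1, m + m)) (x : vertex m) :
  'cV['F_2]_(m.-1) := col (unsplit x) L.

Definition is_char_mx m (X : {set {set vertex m}})
    (L : 'M['F_2]_(m.-1, m + m)) : bool :=
  [forall S in X, free [seq vcol L x | x in S]].

Definition DJ_equiv m : rel 'M['F_2]_(m.-1, m + m) :=
  fun L1 L2 => [exists P : 'M['F_2]_(m.-1), (P \in unitmx) && (L2 == P *m L1)].

Definition char_mxs (m r : nat) : {set 'M['F_2]_(m.-1, m + m)} :=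
  [set L | is_char_mx (Bier (simplex_skeleton m r)) L].

Definition DJ_classes (m r : nat) : {set {set 'M['F_2]_(m.-1, m + m)}} :=
  equivalence_partition (@DJ_equiv m) (char_mxs m r).

(** (I | A), with the columns of I at 1, ..., r+1 and at barred r+2, ..., m-1,
    and those of A at barred 1, ..., r+1, then r+2, ..., m and barred m.
    Hence each a <= m-1 and its barred copy share the a-th columns of I and
    of A, while m and barred m carry the last two columns of A. Ordinals are
    one less than labels, so the test for a label <= r+1 reads [a <= r]. *)
Definition Lambda m (r : nat) (A : 'M['F_2]_(m.-1, m.+1)) :
    'M['F_2]_(m.-1, m + m) :=
  \matrix_(i, c)
    match split c with
    | inl a => if (a <= r)%N then (i == a :> nat)%:R
               else A i (widen_ord (leqnSn m) a)
    | inr a => if (a <= r)%N then A i (widen_ord (leqnSn m) a)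
               else if (a < m.-1)%N then (i == a :> nat)%:R
               else A i ord_max
    end.

(** Below, [i], [j], [s] and [t] are one-based positions, as natural numbers. *)

Definition mx1 m (f : nat -> nat -> 'F_2) : 'M['F_2]_(m.-1, m.+1) :=
  \matrix_(i, j) f i.+1 j.+1.

Definition delta (i j : nat) : 'F_2 := (i == j)%:R.

(** The coordinate [v_i] of v = (v_(r+2), ..., v_(m-1)); 0 outside
    the range of indices. *)
Definition vcoord m r (v : 'rV['F_2]_(m - r - 2)) (i : nat) : 'F_2 :=
  if (r.+2 <= i)%N then
    if insub (i - r.+2)%N is Some k then v 0 k else 0
  else 0.
Arguments vcoord [m] r v i.

Definition mxA0 (m : nat) : 'M['F_2]_(m.-1, m.+1) :=
  mx1 m (fun i j => if (j <= m.-1)%N then delta i j else 1).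

Definition mxA m r (v : 'rV['F_2]_(m - r - 2)) : 'M['F_2]_(m.-1, m.+1) :=
  mx1 m (fun i j =>
    if (j <= m.-1)%N then 1 - delta i j
    else if j == m then (if (i <= r.+1)%N then 1 else vcoord r v i)
    else 1).
Arguments mxA [m] r v.

Definition mxB m r (s : nat) (v : 'rV['F_2]_(m - r - 2)) :
    'M['F_2]_(m.-1, m.+1) :=
  mx1 m (fun i j =>
    if i == s then (if (j <= m)%N then 1 else 0)
    else if (i <= r.+1)%N then (if (j <= m.-1)%N then delta i j else 1)
    else if (j <= m.-1)%N then vcoord r v i + delta i j
    else if j == m then vcoord r v i + 1
    else 1).
Arguments mxB [m] r s v.

Definition mxC m r (t : nat) (v : 'rV['F_2]_(m - r - 2)) :
    'M['F_2]_(m.-1, m.+1) :=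
  mxA0 m
  + mx1 m (fun i j =>
      if j == t then (if (i <= r.+1)%N then 1 + vcoord r v t else vcoord r v i)
      else 0)
  + mx1 m (fun i j => if (i == t) && (j <= m)%N then 1 else 0).
Arguments mxC [m] r t v.

(* Main.v *)
Require Import Defs.
From mathcomp Require Import all_boot all_order all_algebra.
From mathcomp Require Import zify.

Set Implicit Arguments.
Unset Strict Implicit.
Unset Printing Implicit Defensive.

Import GRing.Theory.
Local Open Scope ring_scope.

(** Write a_i and b_i for the columns at the vertex i and at its barred copy,
    and p = r + 1, q = m - r - 2, so that p + q = m - 1.  A face of the Bier
    sphere takes at most p unbarred and at most q barred vertices, with
    disjoint labels.  Over Z/2 linear independence says that no nonempty
    subfamily sums to zero, and subsets of faces are faces; so a matrix is
    characteristic iff no nonempty face has column sum zero ([bier_freeP]).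

    The columns at a facet form an invertible matrix.  Normalising them to
    the identity turns each D--J class into exactly one matrix (I | A)
    ([card_DJ_classes]), and the classes are counted by the admissible A.
    Swapping a few vertices of the base facet for others yields new facets,
    so the corresponding small minors of A equal 1 ([minor_nonzero]).

    Call the labels up to r + 1 tops and the labels from r + 2 to m - 1
    bottoms.  The 2 x 2 and 3 x 3 minors that involve one top i and the
    bottoms leave four patterns for the row and column of i and for the
    block of A on the bottoms ([pencilP]); they are the traces of the
    matrices A_v, B_v, A_0 and C_v^t.  For r = 0 there is a single top, and
    this is already the classification.  For r > 0 the Alexander dual
    situation, one bottom against the tops, gives four patterns as well;
    these must agree for all tops and all bottoms, which fixes v and
    everything else except a part of one column, and a 4 x 4 principal
    minor settles that column ([classify_pos]).

    Conversely, take vectors x_1, ..., x_m whose only linear relation is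
    that their sum is zero.  A_0 is the case a_i = b_i = x_i for all i.  The
    other matrices share one shape: distinguish a label k and a set T of p
    labels other than k, and put a_i = x_i, b_i = x_i + x_k for i in T and
    a_i = x_i + x_k, b_i = x_i for i outside T, i <> k, with a_k = b_k = x_k.
    A parity count shows that no face sums to zero ([bier_free_simplex]); it
    works because a facet uses exactly p unbarred vertices.  When r = 0, the
    vertex a_k lies only in faces whose other vertices are barred, so a_k may
    be any vector outside the hyperplane spanned by the b_i with i <> k: this
    is the freedom of v.  Here k = m gives A_v, a top k gives B_v^k and a
    bottom k gives C_v^k.

    The label k and the vector v can be read off the entries
    ([family_bits_inj]), so beside A_0 there are m * 2 ^ (m - 2) matrices
    for r = 0, and m matrices for r > 0. *)

(** * Characteristic matrices as families without zero-sum faces *)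

Lemma F2_natE (x : 'F_2) : x = (x != 0)%:R.
Proof. by apply/eqP; case: x => [[|[|[]]]]. Qed.

Lemma F2_addxx (V : lmodType 'F_2) (x : V) : x + x = 0.
Proof. by rewrite -mulr2n -scaler_nat (_ : 2%:R = 0 :> 'F_2) ?scale0r //; apply/eqP. Qed.

(** The coefficients of a linear combination over Z/2 are the indicator of a
    subset of the family. *)
Lemma free_imageP (T : finType) (V : vectType 'F_2) (f : T -> V) (S : {set T}) :
  reflect (forall C : {set T}, C \subset S -> \sum_(x in C) f x = 0 -> C = set0)
          (free [seq f x | x in S]).
Proof.
have E (k : 'I_#|S| -> 'F_2) :
  \sum_(i < #|S|) k i *: (image f S)`_i = \sum_(i < #|S|) k i *: f (enum_val i).
  by apply: eq_bigr => i _; rewrite nth_image.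
apply: (iffP (@freeP _ _ _ (image_tuple f S))) => [frS C sCS sC0 | indS k].
  apply/setP=> x; rewrite in_set0; apply/negP=> xC.
  have xS := subsetP sCS _ xC.
  have /(_ _ (enum_rank_in xS x)) := frS (fun i => (enum_val i \in C)%:R).
  rewrite E enum_rankK_in // xC => K1; suff /K1/eqP : \sum_(i < #|S|)
    (enum_val i \in C)%:R *: f (enum_val i) = 0 :> V by rewrite oner_eq0.
  rewrite -[RHS]sC0 -(big_enum_val (fun x => (x \in C)%:R *: f x)).
  rewrite [RHS]big_mkcond [LHS]big_mkcond; apply: eq_bigr => y _.
  case: (boolP (y \in C)) => [/(subsetP sCS)->|_]; first by rewrite scale1r.
  by rewrite scale0r if_same.
rewrite E => sk0 i.
pose C := [set enum_val i | i : 'I_#|S| & k i != 0].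
have C0 : C = set0.
  apply: indS; first by apply/subsetP=> _ /imsetP[j _ ->]; apply: enum_valP.
  rewrite big_imset /=; last by move=> ? ? _ _; apply: enum_val_inj.
  rewrite -[RHS]sk0 big_mkcond /=; apply: eq_bigr => j _.
  by rewrite inE [k j in RHS]F2_natE; case: ifP; rewrite ?scale1r ?scale0r.
apply/eqP/negPn/negP=> ki0; have: enum_val i \in C by apply: imset_f; rewrite inE.
by rewrite C0 inE.
Qed.

Definition bier_free m r (V : zmodType) (a b : 'I_m -> V) : Prop :=
  forall s t : {set 'I_m}, [disjoint s & t] -> (#|s| <= r.+1)%N ->
    (#|t| <= m - r - 2)%N ->
    \sum_(i in s) a i + \sum_(i in t) b i = 0 -> s = set0 /\ t = set0.

Lemma mem_unbarred m (s : {set 'I_m}) x :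
  (x \in unbarred s) = if x is inl i then i \in s else false.
Proof.
case: x => i; last by apply/imsetP=> -[].
by rewrite /unbarred mem_imset // => ? ? [].
Qed.

Lemma mem_barred m (s : {set 'I_m}) x :
  (x \in barred s) = if x is inr i then i \in s else false.
Proof.
case: x => i; first by apply/imsetP=> -[].
by rewrite /barred mem_imset // => ? ? [].
Qed.

Lemma mem_dual_skeleton m r (s : {set 'I_m}) : (r.+2 <= m)%N ->
  (barred s \in alexander_dual (simplex_skeleton m r)) = (#|s| <= m - r - 2)%N.
Proof.
move=> hr; have sC := cardsC s; rewrite card_ord in sC.
have -> : (#|s| <= m - r - 2)%N = (~: s \notin simplex_skeleton m r).
  rewrite inE; lia.
rewrite /alexander_dual mem_imset ?inE // => s1 s2 /setP E; apply/setP=> i.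
by have := E (inr i); rewrite !mem_barred.
Qed.

(** A linear dependency among the columns of a face is a nonempty subface
    with zero column sum, because subsets of faces are faces. *)
Lemma bier_freeP m r (L : 'M['F_2]_(m.-1, m + m)) : (r.+2 <= m)%N ->
  reflect (bier_free r (vcol L \o inl) (vcol L \o inr)) (L \in char_mxs m r).
Proof.
move=> hr.
have sumE (s t : {set 'I_m}) :
  \sum_(x in unbarred s :|: barred t) vcol L x
   = \sum_(i in s) vcol L (inl i) + \sum_(i in t) vcol L (inr i).
  rewrite big_sumType; congr (_ + _); apply: eq_bigl => i;
    by rewrite inE mem_unbarred mem_barred ?orbF.
rewrite inE; apply: (iffP forall_inP) => [chL s t dst les let0 st0 | frL S /imsetP[[s t] + ->]].
  suff: unbarred s :|: barred t = set0.
    move/setP=> E; split; apply/setP=> i; rewrite !inE.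
      by have := E (inl i); rewrite !inE mem_unbarred mem_barred orbF.
    by have := E (inr i); rewrite !inE mem_unbarred mem_barred.
  have faceS : unbarred s :|: barred t \in Bier (simplex_skeleton m r).
    apply/imsetP; exists (s, t) => //=.
    by rewrite inE /= mem_dual_skeleton // inE les let0.
  by have /free_imageP := chL _ faceS; apply=> //; rewrite sumE.
rewrite inE /= mem_dual_skeleton // inE => /and3P[les let0 dst].
apply/free_imageP=> C sC C0.
pose s' := [set i | inl i \in C]; pose t' := [set i | inr i \in C].
have CE : C = unbarred s' :|: barred t'.
  by apply/setP=> -[] i; rewrite !inE mem_unbarred mem_barred inE ?orbF.
have ss : s' \subset s.
  by apply/subsetP=> i; rewrite inE => /(subsetP sC); rewrite inE mem_unbarred mem_barred orbF.
have tt : t' \subset t.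
  by apply/subsetP=> i; rewrite inE => /(subsetP sC); rewrite inE mem_unbarred mem_barred.
have [||||s0 t0] := frL s' t'.
- by rewrite (disjointWl ss) // (disjointWr tt).
- exact: leq_trans (subset_leq_card ss) les.
- exact: leq_trans (subset_leq_card tt) let0.
- by rewrite -sumE -CE.
by rewrite CE s0 t0; apply/setP=> -[] i; rewrite !inE mem_unbarred mem_barred inE.
Qed.

(** * Normal forms for D--J classes *)

Lemma card_set_leq_size m (s : {set 'I_m}) (l : seq nat) :
  (forall i : 'I_m, i \in s -> i.+1 \in l) -> (#|s| <= size l)%N.
Proof.
move=> sl; rewrite cardE -(size_map (fun i : 'I_m => i.+1)); apply: uniq_leq_size.
  by rewrite map_inj_uniq ?enum_uniq // => i j [] /val_inj.
by move=> _ /mapP[i + ->]; rewrite mem_enum => /sl.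
Qed.

Lemma vcol_mul m (P : 'M['F_2]_(m.-1)) (L : 'M['F_2]_(m.-1, m + m)) x :
  vcol (P *m L) x = P *m vcol L x.
Proof. by rewrite /vcol !colE mulmxA. Qed.

Lemma char_mxs_mul m r (P : 'M['F_2]_(m.-1)) (L : 'M['F_2]_(m.-1, m + m)) :
  (r.+2 <= m)%N -> P \in unitmx -> L \in char_mxs m r -> P *m L \in char_mxs m r.
Proof.
move=> hr uP /(bier_freeP _ hr) frL; apply/bier_freeP => // s t dst les let0 E.
apply: frL => //; apply: (can_inj (mulKmx uP)).
rewrite mulmx0 -[RHS]E mulmxDr !mulmx_sumr.
by congr (_ + _); apply: eq_bigr => i _; rewrite /= vcol_mul.
Qed.

Lemma DJ_equivP m (L1 L2 : 'M['F_2]_(m.-1, m + m)) :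
  reflect (exists2 P, P \in unitmx & L2 = P *m L1) (DJ_equiv L1 L2).
Proof.
apply: (iffP existsP) => [[P /andP[uP /eqP E]] | [P uP E]]; first by exists P.
by exists P; rewrite uP E eqxx.
Qed.

Lemma DJ_equiv_refl m : reflexive (@DJ_equiv m).
Proof. by move=> L; apply/DJ_equivP; exists 1%:M; rewrite ?unitmx1 ?mul1mx. Qed.

Lemma DJ_equiv_sym m : symmetric (@DJ_equiv m).
Proof.
suff sym L1 L2 : @DJ_equiv m L1 L2 -> DJ_equiv L2 L1 by move=> L1 L2; apply/idP/idP; apply: sym.
by move=> /DJ_equivP[P uP ->]; apply/DJ_equivP; exists (invmx P); rewrite ?unitmx_inv ?mulKmx.
Qed.

Lemma DJ_equiv_trans m : transitive (@DJ_equiv m).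
Proof.
move=> L2 L1 L3 /DJ_equivP[P uP ->] /DJ_equivP[Q uQ ->]; apply/DJ_equivP.
by exists (Q *m P); rewrite ?unitmx_mul ?uP ?uQ ?mulmxA.
Qed.

Definition base_vertex m r (j : 'I_(m.-1)) : 'I_m + 'I_m :=
  let a := widen_ord (leq_pred m) j in if (j <= r)%N then inl a else inr a.

(** The columns that [Lambda] normalises to the identity. *)
Definition base_block m r (L : 'M['F_2]_(m.-1, m + m)) : 'M['F_2]_(m.-1) :=
  \matrix_(i, j) L i (unsplit (base_vertex r j)).

Lemma base_block_mul m r (P : 'M['F_2]_(m.-1)) (L : 'M['F_2]_(m.-1, m + m)) :
  base_block r (P *m L) = P *m base_block r L.
Proof. by apply/matrixP=> i j; rewrite !mxE; apply: eq_bigr => k _; rewrite !mxE. Qed.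

Lemma base_block_Lambda m r (A : 'M['F_2]_(m.-1, m.+1)) :
  base_block r (Lambda r A) = 1%:M.
Proof.
apply/matrixP=> i j; rewrite !mxE unsplitK /base_vertex.
by case: ifP => /= [->|jr] //; rewrite jr ltn_ord.
Qed.

(** A kernel vector of the base block picks a subset of the base facet with
    zero column sum. *)
Lemma base_block_unit m r (L : 'M['F_2]_(m.-1, m + m)) :
  (r.+2 <= m)%N -> L \in char_mxs m r -> base_block r L \in unitmx.
Proof.
move=> hr /(bier_freeP _ hr) frL; rewrite -unitmx_tr -row_free_unit.
apply/inj_row_free => v vL0.
case: m => [|n] // in hr L v frL vL0 *.
pose u (i : 'I_n.+1) := if insub (i : nat) is Some j then v 0 j != 0 else false.
have uE (j : 'I_n) : u (widen_ord (leqnSn n) j) = (v 0 j != 0).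
  by rewrite /u valK.
have uM : u ord_max = false by rewrite /u insubN //= ltnn.
pose s := [set i : 'I_n.+1 | (i <= r)%N & u i]; pose t := [set i : 'I_n.+1 | (r < i)%N & u i].
have [||||s0 t0] := frL s t.
- by rewrite -setI_eq0; apply/eqP/setP=> i; rewrite !inE; case: leqP; rewrite ?andbF.
- rewrite -(size_iota 1 r.+1); apply: card_set_leq_size => i.
  by rewrite inE mem_iota => /andP[]; lia.
- rewrite -(size_iota r.+2 (n.+1 - r - 2)).
  apply: card_set_leq_size => i; rewrite inE mem_iota => /andP[ri ui].
  have : i != ord_max by apply: contraTneq ui => ->; rewrite uM.
  by rewrite -val_eqE /=; have := ltn_ord i; lia.
- have /matrixP vL0t : base_block r L *m v^T = 0.
    by apply: trmx_inj; rewrite trmx_mul trmxK trmx0.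
  apply/matrixP=> i k; rewrite [k]ord1; have := vL0t i 0; rewrite !mxE => <-; rewrite !summxE.
  rewrite [X in X + _]big_mkcond [X in _ + X]big_mkcond -big_split big_ord_recr /=.
  rewrite !inE uM !andbF !addr0; apply: eq_bigr => j _.
  rewrite !inE uE !mxE /base_vertex ltnNge [v 0 j in RHS]F2_natE.
  have -> : widen_ord (leq_pred n.+1) j = widen_ord (leqnSn n) j by apply: val_inj.
  by case: leqP => _; case: (v 0 j != 0); rewrite ?mulr1 ?mulr0 ?addr0 ?add0r.
apply/rowP=> j; rewrite mxE; apply/eqP/negPn/negP => vj.
case: (leqP j r) => jr.
  have : widen_ord (leqnSn n) j \in s by rewrite inE uE vj jr.
  by rewrite s0 inE.
have : widen_ord (leqnSn n) j \in t by rewrite inE uE vj jr.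
by rewrite t0 inE.
Qed.

(** The vertex that carries the column [j] of A in [Lambda r A]. *)
Definition cobase_vertex n r (j : 'I_n.+2) : 'I_n.+1 + 'I_n.+1 :=
  if insub (j : nat) is Some a then if (j <= r)%N then inr a else inl a
  else inr ord_max.

Lemma Lambda_cobase n r (A : 'M['F_2]_(n, n.+2)) i (j : 'I_n.+2) : (r < n)%N ->
  @Lambda n.+1 r A i (unsplit (cobase_vertex r j)) = A i j.
Proof.
move=> rn; rewrite mxE unsplitK /cobase_vertex.
case: insubP => [a _ aj | nj] /=.
  have -> : j = widen_ord (leqnSn n.+1) a by apply: val_inj.
  by case: leqP => /= ar; [rewrite ar | rewrite leqNgt ar].
rewrite leqNgt rn ltnn; congr (A i _); apply: val_inj => /=.
by have := ltn_ord j; lia.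
Qed.

Lemma Lambda_inj m r : (r.+2 <= m)%N -> injective (@Lambda m r).
Proof.
case: m => // n hr A B AB; apply/matrixP=> i j.
by rewrite -(@Lambda_cobase _ r A) // AB Lambda_cobase.
Qed.

Lemma base_block1_Lambda m r (L : 'M['F_2]_(m.-1, m + m)) : (r.+2 <= m)%N ->
  base_block r L = 1%:M -> exists A, L = Lambda r A.
Proof.
case: m L => // n L hr L1.
pose A : 'M_(n.+1.-1, n.+2) := \matrix_(i, j) L i (unsplit (cobase_vertex r j)).
exists A; apply/matrixP=> i c; rewrite -(splitK c).
have coE j : L i (unsplit (cobase_vertex r j)) = @Lambda n.+1 r A i (unsplit (cobase_vertex r j)).
  by rewrite Lambda_cobase // mxE.
have baE j : L i (unsplit (base_vertex r j)) = @Lambda n.+1 r A i (unsplit (base_vertex r j)).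
  have /matrixP/(_ i j) := @base_block_Lambda n.+1 r A; rewrite -L1.
  by rewrite /base_block !mxE.
case: (split c) => a.
  case: (leqP a r) => ar.
    have an : (a < n)%N by lia.
    have := baE (Ordinal an); rewrite /base_vertex /= ar.
    by rewrite (_ : widen_ord _ _ = a) //; apply: val_inj.
  have := coE (widen_ord (leqnSn n.+1) a); rewrite /cobase_vertex /= valK.
  by rewrite leqNgt ar.
case: (leqP a r) => ar.
  by have := coE (widen_ord (leqnSn n.+1) a); rewrite /cobase_vertex /= valK ar.
case: (ltnP a n) => an.
  have := baE (Ordinal an); rewrite /base_vertex /= leqNgt ar.
  by rewrite (_ : widen_ord _ _ = a) //; apply: val_inj.
have := coE ord_max; rewrite /cobase_vertex insubN ?ltnn //.
rewrite (_ : a = ord_max) //; apply: val_inj => /=; have := ltn_ord a; lia.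
Qed.

Lemma DJ_normal_form m r (L : 'M['F_2]_(m.-1, m + m)) : (r.+2 <= m)%N ->
  L \in char_mxs m r ->
  exists2 A, Lambda r A \in char_mxs m r & DJ_equiv L (Lambda r A).
Proof.
move=> hr chL; have uP := base_block_unit hr chL.
have [|A EA] := @base_block1_Lambda m r (invmx (base_block r L) *m L) hr.
  by rewrite base_block_mul mulVmx.
exists A; first by rewrite -EA char_mxs_mul ?unitmx_inv.
by apply/DJ_equivP; exists (invmx (base_block r L)); rewrite ?unitmx_inv.
Qed.

(** Distinct A give distinct classes: a change of basis that maps (I | A) to
    (I | B) fixes the identity block, hence is trivial. *)
Lemma card_DJ_classes m r : (r.+2 <= m)%N ->
  #|DJ_classes m r| = #|[set A | Lambda r A \in char_mxs m r]|.
Proof.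
move=> hr; have m_gt0 : (0 < m)%N by lia.
pose cls L := [set L' in char_mxs m r | DJ_equiv L L'].
rewrite -(@card_in_imset _ _ (fun A => cls (Lambda r A))) => [|A B]; last first.
  rewrite !inE => chA chB E.
  have : Lambda r B \in cls (Lambda r A) by rewrite E !inE DJ_equiv_refl andbT.
  rewrite inE => /andP[_ /DJ_equivP[P _ EP]].
  have := base_block_mul r P (Lambda r A); rewrite -EP !base_block_Lambda mulmx1 => P1.
  by apply: (Lambda_inj hr); rewrite EP -P1 mul1mx.
apply: eq_card => X; apply/imsetP/imsetP=> -[L].
  move=> chL ->; have [A chA LA] := DJ_normal_form hr chL.
  exists A; first by rewrite inE.
  apply/setP=> L'; rewrite !inE; congr (_ && _).
  apply/idP/idP; apply: DJ_equiv_trans => //; by rewrite DJ_equiv_sym.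
by rewrite inE => chL ->; exists (Lambda r L).
Qed.

(** * Minors of the normal form *)

Lemma F2_natr_odd n : n%:R = (odd n)%:R :> 'F_2.
Proof. by elim: n => //= n IH; rewrite -natr1 IH; case: (odd n); apply/eqP. Qed.

Lemma sum_F2_odd (I : Type) (b : pred I) (C : seq I) :
  \sum_(c <- C) (b c)%:R = (odd (count b C))%:R :> 'F_2.
Proof.
rewrite -F2_natr_odd; elim: C => [|c C IH]; first by rewrite big_nil.
by rewrite big_cons IH -natrD.
Qed.

Lemma vcol_Lambda_inl m r f (a : 'I_m) i :
  vcol (Lambda r (mx1 m f)) (inl a) i 0
  = if (a <= r)%N then (i == a :> nat)%:R else f i.+1 a.+1.
Proof. by rewrite !mxE unsplitK; case: ifP => //; rewrite !mxE. Qed.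

Lemma vcol_Lambda_inr m r f (a : 'I_m) i :
  vcol (Lambda r (mx1 m f)) (inr a) i 0
  = if (a <= r)%N then f i.+1 a.+1
    else if (a < m.-1)%N then (i == a :> nat)%:R else f i.+1 m.+1.
Proof. by rewrite !mxE unsplitK !mxE /= . Qed.

(** Entries in Z/2 are handled as booleans from here on, with addition
    [(+)] and multiplication [&&]; positions count from 1, as in [mx1]. *)
Local Notation bitmx m g := (mx1 m (fun i j => (g i j : bool)%:R)).

(** Used to bound a face of the Bier sphere: the base vertices that occur
    and the rows in [K] have disjoint labels among those of one side. *)
Lemma size_filter_disjoint (w : pred nat) (I K : seq nat) :
  uniq I -> uniq K -> (forall k, k \in K -> w k = false) ->
  (size (filter w I) + count (mem I) K <= size I)%N.
Proof.
move=> uI uK wK; rewrite -size_filter -size_cat; apply: uniq_leq_size.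
  rewrite cat_uniq !filter_uniq //= andbT; apply/hasPn=> k.
  by rewrite !mem_filter => /andP[_ kK]; rewrite wK.
by move=> k; rewrite mem_cat !mem_filter => /orP[]/andP[].
Qed.

(** The columns [C] of A restricted to the rows [K] do not sum to zero.
    Otherwise the total of the columns [C] is supported outside [K], so it is
    a sum of base vertices whose labels avoid [K]; together with the vertices
    of [C] these base vertices would form a face with zero column sum.  The
    hypotheses say that it is a face: no label occurs twice, and on each side
    the vertices brought in by [C] are no more than the base vertices that
    [K] removes.  (Column [c] of A sits at an unbarred vertex iff
    [r.+1 < c <= m].)  A set of columns all of whose subsets satisfy this has
    a nonvanishing minor on [K] if the sizes match. *)
Lemma minor_nonzero m r (g : nat -> nat -> bool) (C K : seq nat) :
  (r.+2 <= m)%N ->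
  Lambda r (bitmx m g) \in char_mxs m r ->
  C != [::] -> uniq C -> uniq K ->
  all (fun c => 0 < c <= m.+1)%N C -> all (fun k => 0 < k < m)%N K ->
  all (fun c => (m <= c)%N || (c \in K)) C ->
  ~~ ((m \in C) && (m.+1 \in C)) ->
  (count (fun c => r.+1 < c <= m) C <= count (fun k => k <= r.+1) K)%N ->
  (count (fun c => (c <= r.+1) || (c == m.+1)) C <= count (fun k => r.+1 < k) K)%N ->
  has (fun l => odd (count (g l) C)) K.
Proof.
move=> hr /(bier_freeP _ hr) frL C0 uC uK C_le K_le CK not_both Ca Cb.
apply/negPn/negP => /hasPn w0.
pose w l := odd (count (g l) C).
have {}w0 l : l \in K -> w l = false by move/w0/negbTE.
pose s := [set a : 'I_m | if (a <= r)%N then w a.+1 else a.+1 \in C].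
pose t := [set a : 'I_m | if (a <= r)%N then a.+1 \in C
                          else if (a < m.-1)%N then w a.+1 else m.+1 \in C].
have wC c : (c < m)%N -> c \in C -> w c = false.
  by move=> cm cC; apply: w0; have := allP CK _ cC; rewrite leqNgt cm.
have [||||s0 t0] := frL s t.
- rewrite -setI_eq0; apply/eqP/setP=> a; rewrite !inE; apply/negP.
  have am := ltn_ord a; case: (leqP a r) => ar /andP[].
    by move=> wa aC; rewrite wC // in wa; lia.
  case: (ltnP a m.-1) => am1 aC; first by rewrite wC //; lia.
  move=> bC; case/negP: not_both; rewrite bC andbT.
  by rewrite (_ : m = a.+1) //; lia.
- have := @size_filter_disjoint w (iota 1 r.+1) K (iota_uniq _ _) uK w0.
  rewrite size_iota (eq_in_count (a2 := fun k => k <= r.+1)%N); last first.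
    by move=> k /(allP K_le); rewrite inE mem_iota; lia.
  rewrite -size_filter in Ca.
  move=> szw; apply: leq_trans szw; apply: leq_trans (leq_add (leqnn _) Ca).
  rewrite -size_cat; apply: card_set_leq_size => a; rewrite inE mem_cat !mem_filter mem_iota.
  have := ltn_ord a; case: (leqP a r) => ar am ->; rewrite ?andbT /=; first by lia.
  by apply/orP; right; lia.
- have := @size_filter_disjoint w (iota r.+2 (m - r - 2)) K (iota_uniq _ _) uK w0.
  rewrite size_iota (eq_in_count (a2 := fun k => r.+1 < k)%N); last first.
    by move=> k /(allP K_le); rewrite inE mem_iota; lia.
  rewrite -size_filter in Cb.
  move=> szw; apply: leq_trans szw; apply: leq_trans (leq_add (leqnn _) Cb).
  rewrite -(size_map (fun c => if c == m.+1 then m else c) (filter _ C)).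
  rewrite -size_cat; apply: card_set_leq_size => a; rewrite inE mem_cat.
  have am := ltn_ord a; case: (leqP a r) => ar aC.
    apply/orP; right; apply/mapP; exists a.+1; last by case: eqP => //; lia.
    by rewrite mem_filter aC; lia.
  case: (ltnP a m.-1) aC => am1 aC.
    by rewrite mem_filter aC mem_iota; lia.
  apply/orP; right; apply/mapP; exists m.+1; last by rewrite eqxx; lia.
  by rewrite mem_filter aC eqxx orbT.
- apply/matrixP=> i k; rewrite [k]ord1 !mxE !summxE.
  rewrite [X in X + _]big_mkcond [X in _ + X]big_mkcond -big_split /=.
  have wi : \sum_(c <- C) (g i.+1 c)%:R + (w i.+1)%:R = 0 :> 'F_2.
    by rewrite sum_F2_odd /w; case: (odd _); apply/eqP.
  rewrite -[RHS]wi.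
  have uI := iota_uniq 1 m.+1.
  have -> : \sum_(c <- C) (g i.+1 c)%:R =
      \sum_(c <- iota 1 m.+1) ((c \in C) && g i.+1 c)%:R :> 'F_2.
    have pC : perm_eq C (filter (mem C) (iota 1 m.+1)).
      apply: uniq_perm; rewrite ?filter_uniq // => c.
      rewrite mem_filter mem_iota; apply/idP/andP=> [cC | []//]; split=> //.
      by have := allP C_le _ cC; lia.
    rewrite (perm_big _ pC) big_filter big_mkcond; apply: eq_bigr => c _.
    by rewrite /=; case: (c \in C).
  rewrite -[m.+1]addn1 iotaD big_cat big_seq1 /= (iotaDl 1 0) big_map.
  rewrite -[m in iota 0 m]subn0 big_mkord.
  have -> : (w i.+1)%:R = \sum_(a < m) ((a < m.-1)%N && w a.+1 && (i == a :> nat))%:R :> 'F_2.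
    have im : (i < m)%N by have := ltn_ord i; lia.
    rewrite (bigD1 (Ordinal im)) //= ltn_ord eqxx andbT big1 ?addr0 // => a.
    by rewrite -val_eqE eq_sym /= => /negbTE->; rewrite andbF.
  have -> : ((1 + m \in C)%N && g i.+1 (1 + m)%N)%:R
      = \sum_(a < m) ((a == m.-1 :> nat) && ((m.+1 \in C) && g i.+1 m.+1))%:R :> 'F_2.
    have mm : (m.-1 < m)%N by lia.
    rewrite (bigD1 (Ordinal mm)) //= eqxx big1 ?addr0 // => a.
    by rewrite -val_eqE /= => /negbTE->.
  rewrite -!big_split; apply: eq_bigr => a _ /=.
  rewrite vcol_Lambda_inl vcol_Lambda_inr !inE add1n.
  have am := ltn_ord a; case: (leqP a r) => ar.
    have -> : (a < m.-1)%N by lia.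
    have -> : (a == m.-1 :> nat) = false by lia.
    case: (w _); case: (a.+1 \in C) => /=; by rewrite ?addr0 ?add0r // addrC.
  case: (ltnP a m.-1) => am1.
    have -> : (a == m.-1 :> nat) = false by lia.
    case: (w _); case: (a.+1 \in C) => /=; by rewrite ?addr0 ?add0r // addrC.
  have -> : (a == m.-1 :> nat) by lia.
  case: (m.+1 \in C); case: (a.+1 \in C) => /=; by rewrite ?addr0 ?add0r.
have [c cC] : exists c, c \in C by case: (C) C0 => // c C' _; exists c; rewrite mem_head.
have /andP[c_gt0 c_le] := allP C_le _ cC.
case: (ltnP c m.+1) => [cm | mc]; last first.
  have mm : (m.-1 < m)%N by lia.
  have : Ordinal mm \in t.
    rewrite inE /= ltnn ifF; last by lia.
    by rewrite (_ : m.+1 = c) //; lia.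
  by rewrite t0 inE.
have am : (c.-1 < m)%N by lia.
case: (leqP c.-1 r) => ar.
  have : Ordinal am \in t by rewrite inE /= ar prednK.
  by rewrite t0 inE.
have : Ordinal am \in s by rewrite inE /= leqNgt ar prednK.
by rewrite s0 inE.
Qed.

(** * One vertex against the opposite side *)

Definition det3 (a b c d e f g h k : bool) : bool :=
  a && (e && k (+) f && h) (+) b && (d && k (+) f && g) (+) c && (d && h (+) e && g).

Lemma det2_columns (a b c d : bool) :
  a || c -> b || d -> (a (+) b) || (c (+) d) -> a && d (+) b && c.
Proof. by case: a; case: b; case: c; case: d. Qed.

(** The seven disjunctions say that no nonempty set of columns sums to zero. *)
Lemma det3_columns (a b c d e f g h k : bool) :
  [|| a, d | g] -> [|| b, e | h] -> [|| c, f | k] ->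
  [|| a (+) b, d (+) e | g (+) h] -> [|| a (+) c, d (+) f | g (+) k] ->
  [|| b (+) c, e (+) f | h (+) k] ->
  [|| a (+) b (+) c, d (+) e (+) f | g (+) h (+) k] ->
  det3 a b c d e f g h k.
Proof.
by case: a; case: b; case: c; case: d; case: e; case: f; case: g; case: h; case: k.
Qed.

(** The row and column of a label [i] against the labels in [Q] on the other
    side, where [y] and [z] are the two extra columns: [y] is 1 on [Q] and [z]
    is 1 at [i].  The constructors are the patterns of the matrices A_v,
    B_v^i, A_0 (an identity block) and C_v^t. *)
Variant pencil_spec (g : nat -> nat -> bool) i (Q : seq nat) y z : Prop :=
| PencilA of ~~ g i i & g i y & {in Q, forall j, ~~ g j j} &
    {in Q &, forall j j', j != j' -> g j j'}
| PencilB of g i i & ~~ g i y & {in Q, forall j, g j j = g j z} &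
    {in Q &, forall j j', j != j' -> g j j' = ~~ g j z}
| PencilI of g i i & g i y & {in Q, forall j, g j z} & {in Q, forall j, g j j} &
    {in Q &, forall j j', j != j' -> ~~ g j j'}
| PencilC t of g i i & g i y & t \in Q & ~~ g t z &
    {in Q, forall j, j != t -> g j z} & {in Q, forall j, j != t -> g j j} &
    {in Q &, forall j j', j != j' -> j' != t -> g j j' = ~~ g j z}.

(** The 2 x 2 minors give [g i j], [g j i] in terms of the diagonal and the
    extra columns.  Substituting them in the 3 x 3 minor leaves a condition
    on each pair of elements of [Q], found by running through the
    values ([key]); a pair must exist, or the patterns would not be forced. *)
Lemma pencilP (g : nat -> nat -> bool) i (Q : seq nat) y z :
  (exists2 jj, (jj.1 \in Q) && (jj.2 \in Q) & jj.1 != jj.2) ->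
  {in Q, forall j, g i j (+) g j j && g i y} ->
  {in Q, forall j, g j i (+) g i i && g j z} ->
  {in Q, forall j, g i i && g j j (+) g i j && g j i} ->
  {in Q &, forall j j', j != j' ->
     det3 (g i i) (g i j') (g i y) (g j i) (g j j') true (g j' i) (g j' j') true} ->
  pencil_spec g i Q y z.
Proof.
move=> [[j0 j1] /= /andP[Qj0 Qj1] j01] hij hji hd h3.
have key : {in Q &, forall j j', j != j' ->
  if g i i then if g i y then (g j z || g j' z) && (g j' z ==> (g j j' == ~~ g j z) && g j' j')
                else [&& g j j == g j z, g j' j' == g j' z & g j j' == ~~ g j z]
  else [&& g i y, ~~ g j j, ~~ g j' j' & g j j']}.
  move=> j j' Qj Qj' jj'.
  move: (hij _ Qj) (hij _ Qj') (hji _ Qj) (hji _ Qj') (hd _ Qj) (hd _ Qj') (h3 _ _ Qj Qj' jj').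
  rewrite /det3; move: (g i j) (g i j') (g j i) (g j' i) (g i i) (g j j) (g j' j') (g j j').
  (* 11 boolean unknowns, checked exhaustively *)
  case: (g i y) (g j z) (g j' z) => [] [] [] [] [] [] [] [] [] [] []; by [].
have other j : j \in Q -> exists2 j', j' \in Q & j != j'.
  by move=> Qj; case: (eqVneq j j0) => [->|]; [exists j1 | exists j0].
case: (boolP (g i i)) (key) => gii keyt.
  case: (boolP (g i y)) keyt => giy keyt.
    case: (boolP (all (fun j => g j z) Q)) => [/allP zQ | /allPn[t Qt zt]].
      apply: PencilI => // [j Qj | j j' Qj Qj' jj'].
        have [j' Qj' ] := other j Qj; rewrite eq_sym => /(keyt _ _ Qj' Qj).
        by rewrite !zQ //= => /andP[].
      by have := keyt _ _ Qj Qj' jj'; rewrite !zQ //= => /andP[/eqP->].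
    have zQ : {in Q, forall j, j != t -> g j z}.
      by move=> j Qj jt; have := keyt _ _ Qj Qt jt; rewrite (negPf zt) orbF andbT.
    apply: (@PencilC _ _ _ _ _ t) => // [j Qj jt | j j' Qj Qj' jj' j't].
      have tj : t != j by rewrite eq_sym.
      by have := keyt _ _ Qt Qj tj; rewrite (zQ j) //= orbT /= => /andP[].
    by have := keyt _ _ Qj Qj' jj'; rewrite (zQ j') //= orbT /= => /andP[/eqP].
  apply: PencilB => // [j Qj | j j' Qj Qj' jj'].
    by have [j' Qj' /(keyt _ _ Qj Qj')/and3P[/eqP]] := other j Qj.
  by have /and3P[_ _ /eqP] := keyt _ _ Qj Qj' jj'.
apply: PencilA => // [|j Qj | j j' Qj Qj' jj'].
- by have /andP[] := keyt _ _ Qj0 Qj1 j01.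
- by have [j' Qj' /(keyt _ _ Qj Qj')/and4P[]] := other j Qj.
by have /and4P[] := keyt _ _ Qj Qj' jj'.
Qed.

(** * Classification of the normal forms *)

(** The base facet has its unbarred vertices at the top labels and its barred
    ones at the bottom labels. *)
Definition top_labels r := iota 1 r.+1.
Definition bot_labels m r := iota r.+2 (m - r - 2).

Lemma mem_tops r i : (i \in top_labels r) = (0 < i <= r.+1)%N.
Proof. by rewrite mem_iota. Qed.

Lemma mem_bots m r i : (i \in bot_labels m r) = (r.+1 < i < m)%N.
Proof. by rewrite mem_iota; lia. Qed.

Definition agree_entries m (g g' : nat -> nat -> bool) : Prop :=
  forall i j, (0 < i < m)%N -> (0 < j <= m.+1)%N -> g i j = g' i j.

(** The boolean counterparts of [mxA0], [mxA], [mxB] and [mxC]. *)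
Definition bitsA0 m i j := (m <= j)%N || (i == j).

Definition bitsA m r (v : nat -> bool) i j :=
  if (j < m)%N then i != j else if j == m then (i <= r.+1)%N || v i else true.

Definition bitsB m r s (v : nat -> bool) i j :=
  if i == s then (j <= m)%N
  else if (i <= r.+1)%N then (m <= j)%N || (i == j)
  else if (j < m)%N then v i (+) (i == j)
  else if j == m then ~~ v i else true.

Definition bitsC m r t (v : nat -> bool) i j :=
  bitsA0 m i j (+) (j == t) && (if (i <= r.+1)%N then ~~ v t else v i)
  (+) (i == t) && (j <= m)%N.

Lemma bitsC_col m r t v i : (r.+1 < t < m)%N ->
  bitsC m r t v i t = if (i <= r.+1)%N then ~~ v t else v i.
Proof.
move=> ht; rewrite /bitsC /bitsA0 eqxx.
have -> : (m <= t)%N = false by lia.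
have -> : (t <= m)%N by lia.
by rewrite andbT /=; case: (eqVneq i t) => [->|_]; rewrite ?addbF //=;
   case: ifP => _; case: (v t).
Qed.

Lemma bitsC_other m r t v i j : j != t ->
  bitsC m r t v i j = bitsA0 m i j (+) (i == t) && (j <= m)%N.
Proof. by move=> /negbTE jt; rewrite /bitsC jt /= addbF. Qed.

Local Ltac bits :=
  intros; repeat match goal with
  | H : is_true (_ \in top_labels _) |- _ => rewrite mem_tops in H
  | H : is_true (_ \in bot_labels _ _) |- _ => rewrite mem_bots in H end;
  rewrite /bitsA0 /bitsA /bitsB /bitsC /bitsA0;
  repeat match goal with
  | |- context [if ?b then _ else _] => case: (boolP b) => ? end;
  try lia.

Section Minors.
Variables (m r : nat) (g : nat -> nat -> bool).
Hypothesis hr : (r.+2 <= m)%N.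
Hypothesis chg : Lambda r (bitmx m g) \in char_mxs m r.

Local Notation tops := (top_labels r).
Local Notation bots := (bot_labels m r).

Local Ltac minor C K :=
  have := @minor_nonzero m r g C K hr chg;
  rewrite /= ?oddD ?oddb ?addbF ?addbA ?orbF; apply; rewrite ?inE; lia.

Lemma top_last i : i \in tops -> g i m.
Proof. by rewrite mem_tops => it; minor [:: m] [:: i]. Qed.

Lemma bot_last j : j \in bots -> g j m.+1.
Proof. by rewrite mem_bots => jt; minor [:: m.+1] [:: j]. Qed.

(** Rows i, j and columns j, m + 1: the facet drops the vertices i and
    barred j of the base, and takes j and barred m. *)
Lemma minor_top_bot i j : i \in tops -> j \in bots -> g i j (+) g j j && g i m.+1.
Proof.
move=> it jb; have := bot_last jb; move: it jb; rewrite mem_tops mem_bots => it jb gj.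
have: g i j && true (+) g i m.+1 && g j j.
  rewrite -gj; apply: det2_columns.
  - minor [:: j] [:: i; j].
  - minor [:: m.+1] [:: i; j].
  - minor [:: j; m.+1] [:: i; j].
by rewrite andbT [in X in _ (+) X]andbC.
Qed.

(** The dual of [minor_top_bot]: the facet takes barred i and m. *)
Lemma minor_bot_top i j : i \in tops -> j \in bots -> g j i (+) g i i && g j m.
Proof.
move=> it jb; have := top_last it; move: it jb; rewrite mem_tops mem_bots => it jb gi.
have: g i i && g j m (+) true && g j i.
  rewrite -gi; apply: det2_columns.
  - minor [:: i] [:: i; j].
  - minor [:: m] [:: i; j].
  - minor [:: i; m] [:: i; j].
by rewrite addbC.
Qed.

(** The facet swaps i for barred i and barred j for j. *)
Lemma minor_diag i j : i \in tops -> j \in bots ->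
  g i i && g j j (+) g i j && g j i.
Proof.
rewrite mem_tops mem_bots => it jb; apply: det2_columns.
- minor [:: i] [:: i; j].
- minor [:: j] [:: i; j].
- minor [:: i; j] [:: i; j].
Qed.

(** The facet drops i, barred j, barred j' and takes barred i, j', barred m. *)
Lemma minor_top_bots i j j' : i \in tops -> j \in bots -> j' \in bots -> j != j' ->
  det3 (g i i) (g i j') (g i m.+1) (g j i) (g j j') true (g j' i) (g j' j') true.
Proof.
move=> it jb jb'; have := bot_last jb; have := bot_last jb'.
move: it jb jb'; rewrite mem_tops !mem_bots => it jb jb' gj' gj jj'.
rewrite -[X in det3 _ _ _ _ _ X]gj -[X in det3 _ _ _ _ _ _ _ _ X]gj'.
apply: det3_columns.
- minor [:: i] [:: i; j; j'].
- minor [:: j'] [:: i; j; j'].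
- minor [:: m.+1] [:: i; j; j'].
- minor [:: i; j'] [:: i; j; j'].
- minor [:: i; m.+1] [:: i; j; j'].
- minor [:: j'; m.+1] [:: i; j; j'].
- minor [:: i; j'; m.+1] [:: i; j; j'].
Qed.

Lemma minor_bot_tops i i' j : i \in tops -> i' \in tops -> j \in bots -> i != i' ->
  det3 (g j j) (g j i') (g j m) (g i j) (g i i') true (g i' j) (g i' i') true.
Proof.
move=> it it' jb; have := top_last it; have := top_last it'.
move: it it' jb; rewrite !mem_tops mem_bots => it it' jb gi' gi ii'.
rewrite -[X in det3 _ _ _ _ _ X]gi -[X in det3 _ _ _ _ _ _ _ _ X]gi'.
apply: det3_columns.
- minor [:: j] [:: j; i; i'].
- minor [:: i'] [:: j; i; i'].
- minor [:: m] [:: j; i; i'].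
- minor [:: j; i'] [:: j; i; i'].
- minor [:: j; m] [:: j; i; i'].
- minor [:: i'; m] [:: j; i; i'].
- minor [:: j; i'; m] [:: j; i; i'].
Qed.

(** Only one column sum of the principal 4 x 4 minor is needed; it decides
    the column of A at the exceptional top, which the smaller minors leave
    open. *)
Lemma minor_two_tops i s j j' : i \in tops -> s \in tops -> i != s ->
  j \in bots -> j' \in bots -> j != j' ->
  [|| g i i (+) g i s, g s i (+) g s s, g j i (+) g j s | g j' i (+) g j' s].
Proof.
rewrite !mem_tops !mem_bots => it st ii' jb jb' jj'.
minor [:: i; s] [:: i; s; j; j'].
Qed.

Lemma minor_two_bots j t i i' : j \in bots -> t \in bots -> j != t ->
  i \in tops -> i' \in tops -> i != i' ->
  [|| g j j (+) g j t, g t j (+) g t t, g i j (+) g i t | g i' j (+) g i' t].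
Proof.
rewrite !mem_tops !mem_bots => it st ii' jb jb' jj'.
minor [:: j; t] [:: j; t; i; i'].
Qed.

Lemma pencil_top i : i \in tops -> (r.+3 < m)%N ->
  pencil_spec g i bots m.+1 m.
Proof.
move=> it hq; apply: pencilP => [|j jb|j jb|j jb|j j' jb jb' jj'].
- by exists (r.+2, r.+3); rewrite ?mem_bots /=; lia.
- exact: minor_top_bot.
- exact: minor_bot_top.
- exact: minor_diag.
- exact: minor_top_bots.
Qed.

Lemma pencil_bot j : j \in bots -> (0 < r)%N ->
  pencil_spec g j tops m m.+1.
Proof.
move=> jb r_gt0; apply: pencilP => [|i it|i it|i it|i i' it it' ii'].
- by exists (1, 2); rewrite ?mem_tops //=; lia.
- exact: minor_bot_top.
- exact: minor_top_bot.
- by rewrite andbC [X in _ (+) X]andbC; exact: minor_diag.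
- exact: minor_bot_tops.
Qed.

(** The relations that [top_last], [bot_last], [minor_top_bot] and
    [minor_bot_top] impose, read as equations for the entries they determine:
    a matrix [g'] satisfying them agrees with [g] as soon as it does on the
    remaining entries. *)
Definition minor_consistent (g' : nat -> nat -> bool) : Prop :=
  [/\ {in tops, forall i, g' i m}, {in bots, forall j, g' j m.+1},
      {in tops & bots, forall i j, g' i j = ~~ (g' j j && g' i m.+1)}
    & {in tops & bots, forall i j, g' j i = ~~ (g' i i && g' j m)}].

Lemma agree_blocks (g' : nat -> nat -> bool) : minor_consistent g' ->
  {in tops, forall i, g i i = g' i i} ->
  {in bots, forall j, g j j = g' j j} ->
  {in tops, forall i, g i m.+1 = g' i m.+1} ->
  {in bots, forall j, g j m = g' j m} ->
  {in tops &, forall i i', i != i' -> g i i' = g' i i'} ->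
  {in bots &, forall j j', j != j' -> g j j' = g' j j'} ->
  agree_entries m g g'.
Proof.
move=> [Hm HM Hij Hji] Hi Hj Hy Hz Htt Hbb i j im jm.
have split_ix k : (0 < k < m)%N -> (k \in tops) || (k \in bots).
  by rewrite mem_tops mem_bots; lia.
case: (eqVneq j m.+1) => [->|jM].
  case/orP: (split_ix _ im) => ib; first exact: Hy.
  by rewrite bot_last // HM.
case: (eqVneq j m) => [->|jM'].
  case/orP: (split_ix _ im) => ib; last exact: Hz.
  by rewrite top_last // Hm.
have {}jm : (0 < j < m)%N by lia.
case: (eqVneq i j) => [<-|ij].
  by case/orP: (split_ix _ im) => ib; [exact: Hi | exact: Hj].
case/orP: (split_ix _ im) => ib; case/orP: (split_ix _ jm) => jb.
- exact: Htt.
- by rewrite Hij // -Hj // -Hy //; move: (minor_top_bot ib jb); case: (g i j); case: (_ && _).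
- by rewrite Hji // -Hi // -Hz //; move: (minor_bot_top jb ib); case: (g i j); case: (_ && _).
- exact: Hbb.
Qed.

Lemma bitsA0_consistent : minor_consistent (bitsA0 m).
Proof. by split=> [i it|j jb|i j it jb|i j it jb]; bits. Qed.

Lemma bitsA_consistent v : minor_consistent (bitsA m r v).
Proof. by split=> [i it|j jb|i j it jb|i j it jb]; bits. Qed.

(** A top i <> s and a bottom j force [v j = false], while for r = 0 there is
    no such i. *)
Lemma bitsB_consistent s v : s \in tops -> r = 0%N \/ v =1 xpred0 ->
  minor_consistent (bitsB m r s v).
Proof.
move=> st rv; split=> [i it|j jb|i j it jb|i j it jb]; first by bits.
- by bits.
- case: (eqVneq i s) => [->|is_]; first by bits.
  by case: rv => [r0 | v0]; [|have := v0 j]; bits.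
by case: (eqVneq i s) => [->|is_]; bits.
Qed.

Lemma bitsC_consistent t v : t \in bots -> minor_consistent (bitsC m r t v).
Proof.
rewrite mem_bots => tb.
have diag i : (0 < i < m)%N -> i != t -> bitsC m r t v i i.
  by move=> im it; rewrite bitsC_other // /bitsA0 eqxx (negbTE it) orbT.
split=> [i|j|i j|i j]; rewrite ?mem_tops ?mem_bots => it.
- by rewrite bitsC_other /bitsA0; lia.
- by rewrite bitsC_other /bitsA0; lia.
- move=> jb; case: (eqVneq j t) => [->|jt]; last first.
    by rewrite diag ?bitsC_other /bitsA0 //; lia.
  rewrite !bitsC_col // bitsC_other /bitsA0; last by lia.
  have -> : (i <= r.+1)%N by lia.
  have -> : (t <= r.+1)%N = false by lia.
  by rewrite ltnn andbF addbF leqnSn andbT.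
move=> jb; rewrite diag //; [|lia..].
rewrite !bitsC_other /bitsA0; lia.
Qed.

(** With a single top the four patterns of [pencil_top] determine everything
    but v, which is read off the column m for A_v and B_v^1 and off the
    column t for C_v^t. *)
Lemma classify0 : r = 0%N -> (3 < m)%N ->
  [\/ agree_entries m g (bitsA0 m), exists v, agree_entries m g (bitsA m r v),
      exists v, agree_entries m g (bitsB m r 1 v)
    | exists2 t, t \in bots & exists v, agree_entries m g (bitsC m r t v)].
Proof.
move=> r0 m4.
have top1 i : i \in tops -> i = 1%N by rewrite mem_tops; lia.
have one_top : 1%N \in tops by rewrite mem_tops.
have [] := pencil_top one_top; first by lia.
- move=> a1 y1 aj gjj; constructor 2; exists (fun j => g j m).
  apply: agree_blocks; first exact: bitsA_consistent.
  + move=> i /top1->; bits.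
  + move=> j jb; rewrite (negPf (aj _ jb)); bits.
  + move=> i /top1->; rewrite y1; bits.
  + by move=> j jb; bits.
  + by move=> i i' /top1-> /top1->.
  + move=> j j' jb jb' jj'; rewrite gjj //; bits.
- move=> a1 y1 aj gjj; constructor 3; exists (fun j => ~~ g j m).
  apply: agree_blocks; first by apply: bitsB_consistent => //; tauto.
  + move=> i /top1->; bits.
  + move=> j jb; rewrite aj //; bits.
  + move=> i /top1->; rewrite (negPf y1); bits.
  + by move=> j jb; bits.
  + by move=> i i' /top1-> /top1->.
  + move=> j j' jb jb' jj'; rewrite gjj //; bits.
- move=> a1 y1 zj aj gjj; constructor 1.
  apply: agree_blocks; first exact: bitsA0_consistent.
  + move=> i /top1->; bits.
  + move=> j jb; rewrite aj //; bits.
  + move=> i /top1->; rewrite y1; bits.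
  + move=> j jb; rewrite zj //; bits.
  + by move=> i i' /top1-> /top1->.
  + move=> j j' jb jb' jj'; rewrite (negPf (gjj _ _ jb jb' jj')) //; bits.
move=> t a1 y1 tb zt zj aj gjj; constructor 4; exists t => //.
exists (fun j => g j t); apply: agree_blocks; first exact: bitsC_consistent.
- move=> i /top1->; bits.
- move=> j jb; case: (eqVneq j t) => [->|jt]; last rewrite aj //; bits.
- move=> i /top1->; rewrite y1; bits.
- move=> j jb; case: (eqVneq j t) => [->|jt]; [rewrite (negPf zt) | rewrite zj //]; bits.
- by move=> i i' /top1-> /top1->.
move=> j j' jb jb' jj'; case: (eqVneq j' t) => [->|j't].
  rewrite bitsC_col -?mem_bots //; bits.
rewrite bitsC_other // gjj //; case: (eqVneq j t) => [->|jt]; first by rewrite zt; bits.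
rewrite zj //; bits.
Qed.

(** If one diagonal entry vanishes, so do all those on the other side, and
    back: this is A_v with v = (1, ..., 1).  Otherwise the diagonal is 1.  A
    zero at s in the column m + 1 puts s in the second pattern, so that the
    column m is 1 on the bottoms and each bottom sees s as its exceptional
    top: this is B_0^s.  If there is no such zero, a zero at t in the column m
    gives C_v^t by the same argument with the sides exchanged, and no zero at
    all gives A_0. *)
Lemma classify_pos : (0 < r)%N -> (r.+3 < m)%N ->
  [\/ agree_entries m g (bitsA0 m), agree_entries m g (bitsA m r xpredT),
      exists2 s, s \in tops & agree_entries m g (bitsB m r s xpred0)
    | exists2 t, t \in bots & agree_entries m g (bitsC m r t (fun i => i == t))].
Proof.
move=> r_gt0 rm.
have one_top : 1%N \in tops by rewrite mem_tops.
have b0 : r.+2 \in bots by rewrite mem_bots; lia.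
have Atop i : i \in tops -> ~~ g i i -> forall j, j \in bots -> ~~ g j j.
  by move=> it /negP gii; case: (pencil_top it rm).
have Abot j : j \in bots -> ~~ g j j -> forall i, i \in tops -> ~~ g i i.
  by move=> jb /negP gjj; case: (pencil_bot jb r_gt0).
case: (boolP (g 1 1)) => g11; last first.
  have aj := Atop _ one_top g11; have ai := Abot _ b0 (aj _ b0).
  constructor 2; apply: agree_blocks; first exact: bitsA_consistent.
  - by move=> i it; rewrite (negPf (ai _ it)); bits.
  - by move=> j jb; rewrite (negPf (aj _ jb)); bits.
  - by move=> i it; case: (pencil_top it rm); rewrite (negPf (ai _ it)) // => _ -> //; bits.
  - by move=> j jb; case: (pencil_bot jb r_gt0); rewrite (negPf (aj _ jb)) // => _ -> //; bits.
  - move=> i i' it it' ii'; case: (pencil_bot b0 r_gt0); rewrite (negPf (aj _ b0)) //.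
    by move=> _ _ _ -> //; bits.
  - move=> j j' jb jb' jj'; case: (pencil_top one_top rm); rewrite (negPf g11) //.
    by move=> _ _ _ -> //; bits.
have aj j : j \in bots -> g j j.
  by move=> jb; apply: contraLR g11 => gjj; apply: Abot jb gjj _ one_top.
have ai i : i \in tops -> g i i.
  by move=> it; apply: contraLR (aj _ b0) => gii; apply: Atop it gii _ b0.
case: (boolP (all (fun i => g i m.+1) tops)) => [/allP yi | /allPn[s st ys]]; last first.
  have [zj gjj] : (forall j, j \in bots -> g j m) /\
      {in bots &, forall j j', j != j' -> ~~ g j j'}.
    case: (pencil_top st rm); rewrite ?ai // ?(negPf ys) // => _ _ azj gjj.
    have zj j : j \in bots -> g j m by move=> jb; rewrite -azj ?aj.
    by split=> // j j' jb jb' jj'; rewrite gjj // zj.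
  have [yi gii] : {in tops, forall i, i != s -> g i m.+1} /\
      {in tops &, forall i i', i != i' -> i' != s -> g i i' = ~~ g i m.+1}.
    case: (pencil_bot b0 r_gt0); rewrite ?aj ?zj //.
      by move=> _ _ /(_ s st); rewrite (negPf ys).
    move=> t _ _ tt yt yi' _ gii; suff -> : s = t by split.
    by apply/eqP/negPn/negP => /(yi' _ st); rewrite (negPf ys).
  constructor 3; exists s => //.
  apply: agree_blocks; first by apply: bitsB_consistent => //; right.
  - by move=> i it; rewrite ai //; bits.
  - by move=> j jb; rewrite aj //; bits.
  - move=> i it; case: (eqVneq i s) => [->|is_]; [rewrite (negPf ys) | rewrite yi //]; bits.
  - by move=> j jb; rewrite zj //; bits.
  - move=> i i' it it' ii'; case: (eqVneq i' s) => [?|i's]; last first.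
      rewrite gii //; case: (eqVneq i s) => [->|is_]; [rewrite (negPf ys) | rewrite yi //]; bits.
    (* the entry (i, s) is the one left free by the patterns *)
    subst i'.
    have b1 : r.+3 \in bots by rewrite mem_bots; lia.
    have b01 : r.+2 != r.+3 by lia.
    have := minor_two_tops it st ii' b0 b1 b01.
    have gsi : g s i by rewrite gii // ?(negPf ys) // eq_sym.
    have gji j k : j \in bots -> k \in tops -> g j k = false.
      by move=> jb kt; have := minor_bot_top kt jb; rewrite ai // zj //; case: (g j k).
    rewrite gsi !ai // (gji _ _ b0 it) (gji _ _ b0 st) (gji _ _ b1 it) (gji _ _ b1 st).
    by case: (g i s) => //; bits.
  - by move=> j j' jb jb' jj'; rewrite (negPf (gjj _ _ jb jb' jj')); bits.
case: (pencil_top one_top rm); rewrite ?g11 ?yi //.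
  move=> _ _ zj _ gjj; constructor 1; apply: agree_blocks; first exact: bitsA0_consistent.
  - by move=> i it; rewrite ai //; bits.
  - by move=> j jb; rewrite aj //; bits.
  - by move=> i it; rewrite yi //; bits.
  - by move=> j jb; rewrite zj //; bits.
  - move=> i i' it it' ii'; case: (pencil_bot b0 r_gt0); rewrite ?aj ?zj //.
      by move=> _ _ _ _ gii; rewrite (negPf (gii _ _ it it' ii')); bits.
    by move=> t _ _ tt; rewrite yi.
  - by move=> j j' jb jb' jj'; rewrite (negPf (gjj _ _ jb jb' jj')); bits.
move=> t _ _ tb zt zj _ gjj; constructor 4; exists t => //.
apply: agree_blocks; first exact: bitsC_consistent.
- by move=> i it; rewrite ai //; bits.
- by move=> j jb; rewrite aj //; case: (eqVneq j t) => [->|jt]; bits.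
- by move=> i it; rewrite yi //; bits.
- by move=> j jb; case: (eqVneq j t) => [->|jt]; [rewrite (negPf zt) | rewrite zj //]; bits.
- move=> i i' it it' ii'; case: (pencil_bot tb r_gt0); rewrite ?aj ?(negPf zt) // => _ _.
  by move=> _ ->//; rewrite yi //; bits.
move=> j j' jb jb' jj'; case: (eqVneq j' t) => [?|j't]; last first.
  rewrite gjj //; case: (eqVneq j t) => [->|jt]; [rewrite (negPf zt) | rewrite zj //]; bits.
(* the entry (j, t) is the one left free by the patterns *)
subst j'.
have t2 : 2%N \in tops by rewrite mem_tops.
have := minor_two_bots jb tb jj' one_top t2 isT.
have gtj : g t j by rewrite gjj // ?(negPf zt) // eq_sym.
have gij i k : i \in tops -> k \in bots -> g i k = false.
  by move=> it kb; have := minor_top_bot it kb; rewrite aj // yi //; case: (g i k).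
rewrite gtj !aj // (gij _ _ one_top jb) (gij _ _ one_top tb) (gij _ _ t2 jb) (gij _ _ t2 tb).
by case: (g j t) => //; bits.
Qed.
End Minors.

(** * Families built from a simplex *)

Lemma bier_free_doubled m r (V : zmodType) (x a b : 'I_m -> V) :
  (r.+2 <= m)%N ->
  (forall S : {set 'I_m}, \sum_(i in S) x i = 0 -> S = set0 \/ S = setT) ->
  a =1 x -> b =1 x -> bier_free r a b.
Proof.
move=> hr hx ax bx s t dst les let0.
rewrite (eq_bigr x (fun i _ => ax i)) [X in _ + X](eq_bigr x (fun i _ => bx i)).
rewrite -bigU //= -(eq_bigl _ _ (fun i => in_setU i s t)) => /hx[/eqP | ST].
  by rewrite setU_eq0 => /andP[/eqP-> /eqP->].
have := cardsU s t; rewrite ST cardsT card_ord (disjoint_setI0 dst) cards0; lia.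
Qed.

(** The columns of a face (s, t) sum to the sum of the x_i over the union S of
    s and t, plus c times x_k, where c counts the members of the face other
    than k that carry the extra x_k.  As the sum of all x_i is the only
    relation, a zero sum forces S to be empty or everything if c is even, and
    S to be [{k}] or the complement of k if c is odd.  The size of S excludes
    everything; S = [{k}] has c = 0; and a facet missing k has as many
    elements of s outside T as elements of t inside T, since s and T both
    have r + 1 elements, so c is even. *)
Lemma bier_free_simplex m r (V : lmodType 'F_2) (x a b : 'I_m -> V)
    (k : 'I_m) (T : {set 'I_m}) :
  (r.+2 <= m)%N ->
  (forall S : {set 'I_m}, \sum_(i in S) x i = 0 -> S = set0 \/ S = setT) ->
  k \notin T -> #|T| = r.+1 ->
  (forall i, i != k -> a i = x i + x k *+ (i \notin T)) ->
  (forall i, b i = x i + x k *+ (i \in T)) ->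
  a k = x k \/ r = 0%N /\ (forall t : {set 'I_m}, k \notin t ->
                             a k + \sum_(i in t) b i <> 0) ->
  bier_free r a b.
Proof.
move=> hr hx kT cT ha hb a_k s t dst les let0 sum0.
have kt : k \in s -> k \notin t by move=> ks; rewrite (disjointFr dst ks).
have hk : k \in s -> a k = x k.
  case: a_k => // -[r0 nz] ks; case: (nz t (kt ks)); rewrite -[RHS]sum0.
  suff -> : s = [set k] by rewrite big_set1.
  by apply/eqP; rewrite eq_sym eqEcard sub1set ks cards1 -[1%N]/(0.+1) -r0.
pose c := (#|(s :\: T) :\ k| + #|t :&: T|)%N.
have sumE : \sum_(i in s :|: t) x i + x k *+ c = 0.
  have cardE (A : {set 'I_m}) (B : pred 'I_m) : (\sum_(i in A) B i)%N = #|[set i in A | B i]|.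
    by rewrite -sum1_card big_mkcond [RHS]big_mkcond; apply: eq_bigr => i _;
       rewrite inE; case: (_ \in A) => //; case: (B i).
  have sa : \sum_(i in s) a i = \sum_(i in s) x i + x k *+ #|(s :\: T) :\ k|.
    rewrite (_ : (s :\: T) :\ k = [set i in s | (i != k) && (i \notin T)]); last first.
      by apply/setP=> i; rewrite !inE; case: (i \in s); rewrite ?andbF ?andbT.
    rewrite -cardE -sumrMnr -big_split; apply: eq_bigr => i si /=.
    case: (eqVneq i k) si => [->|ik _] ; last by rewrite ha.
    by move=> ks; rewrite hk // addr0.
  have sb : \sum_(i in t) b i = \sum_(i in t) x i + x k *+ #|t :&: T|.
    rewrite (_ : t :&: T = [set i in t | i \in T]); last by apply/setP=> i; rewrite !inE.
    by rewrite -cardE -sumrMnr -big_split; apply: eq_bigr => i _ /=.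
  rewrite -[RHS]sum0 sa sb /c mulrnDr addrACA; congr (_ + _).
  by rewrite -bigU //=; apply: eq_bigl => i; rewrite !inE.
have x2 : x k + x k = 0 := F2_addxx (x k).
have cS : #|s :|: t| = (#|s| + #|t|)%N by rewrite cardsU (disjoint_setI0 dst) cards0 subn0.
have S0 : s :|: t = set0 -> s = set0 /\ t = set0.
  by move=> /eqP; rewrite setU_eq0 => /andP[/eqP-> /eqP->].
have ck : x k *+ c = x k *+ odd c.
  by rewrite -[c in LHS]odd_double_half mulrnDr -muln2 mulnC mulrnA mulr2n x2 mul0rn addr0.
move: sumE; rewrite ck; case: (boolP (odd c)) => oc; last first.
  rewrite addr0 => /hx[/S0 // | ST].
  by move: cS; rewrite ST cardsT card_ord; lia.
rewrite mulr1n; case: (boolP (k \in s :|: t)) => kS.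
  rewrite (big_setD1 k kS) /= addrAC x2 add0r => /hx[Sk0 | SkT]; last first.
    by have := in_setT k; rewrite -SkT !inE eqxx.
  have Sk : s :|: t = [set k] by rewrite -(setD1K kS) Sk0 setU0.
  have s_k : (s :\: T) :\ k = set0.
    apply/setP=> i; rewrite !inE; case: eqVneq => //= ik; apply/negP => /andP[_ si].
    by have /setP/(_ i) := Sk; rewrite !inE si (negPf ik).
  have t_T : t :&: T = set0.
    apply/setP=> i; rewrite !inE; apply/negP => /andP[ti iT].
    have /setP/(_ i) := Sk; rewrite !inE ti orbT => /esym/eqP ik.
    by rewrite ik (negPf kT) in iT.
  by move: oc; rewrite /c s_k t_T cards0.
rewrite addrC -big_setU1 // => /hx[kS0 | kST].
  by have := setU11 k (s :|: t); rewrite kS0 inE.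
have := cardsU1 k (s :|: t); rewrite kST cardsT card_ord kS cS => cm.
have ks : k \notin s by apply: contra kS => ks; rewrite inE ks.
have TS : T \subset s :|: t.
  apply/subsetP=> i iT; have := in_setT i; rewrite -kST in_setU1 => /orP[/eqP ik|//].
  by rewrite ik (negPf kT) in iT.
have : #|T| = (#|s :&: T| + #|t :&: T|)%N.
  rewrite -{1}(setIidPr TS) setIUl cardsU setIACA (disjoint_setI0 dst) set0I.
  by rewrite cards0 subn0.
have := cardsID T s; have sk : (s :\: T) :\ k = s :\: T.
  by apply/setP=> i; rewrite !inE; case: eqVneq => //= ->; rewrite (negPf ks) andbF.
move: oc; rewrite /c sk cT => oc sT TE.
have st : #|s :\: T| = #|t :&: T| by lia.
by move: oc; rewrite st addnn odd_double.
Qed.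

(** * Bit matrices built from a simplex *)

Lemma F2_natr_addb (b c : bool) : (b (+) c)%:R = b%:R + c%:R :> 'F_2.
Proof. by case: b; case: c; apply/eqP. Qed.

Lemma natr_mulrb (b c : bool) : b%:R *+ c = (b && c)%:R :> 'F_2.
Proof. by case: b; case: c. Qed.

(** [acol] and [bcol] are the entries of the columns of (I | A) at the
    unbarred and at the barred vertices. *)
Definition acol r (g : nat -> nat -> bool) i j :=
  if (j <= r.+1)%N then i == j else g i j.

Definition bcol m r (g : nat -> nat -> bool) i j :=
  if (j <= r.+1)%N then g i j else if (j < m)%N then i == j else g i m.+1.

Lemma card_labels m (T : seq nat) : uniq T -> all (fun l => 0 < l <= m)%N T ->
  #|[set j : 'I_m | j.+1 \in T]| = size T.
Proof.
move=> uT T_le; apply/eqP; rewrite eqn_leq card_set_leq_size => [|i]; last by rewrite inE.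
rewrite cardE -(size_map (fun j : 'I_m => j.+1)); apply: uniq_leq_size => // l lT.
have := allP T_le _ lT => lm; have lm' : (l.-1 < m)%N by lia.
apply/mapP; exists (Ordinal lm'); last by rewrite /= prednK //; case/andP: lm.
by rewrite mem_enum inE /= prednK //; case/andP: lm.
Qed.

(** The columns of [X] satisfy no linear relation other than possibly the sum
    of all of them. *)
Definition simplex_config m (X : nat -> nat -> bool) : Prop :=
  forall S : {set 'I_m},
    (forall i, (0 < i < m)%N -> \sum_(j in S) (X i j.+1)%:R = 0 :> 'F_2) ->
  S = set0 \/ S = setT.

Section FromSimplex.
Variables (m r : nat) (g : nat -> nat -> bool).
Hypothesis hr : (r.+2 <= m)%N.
Let L := Lambda r (bitmx m g).

Lemma vcol_inl_bits (a : 'I_m) i : vcol L (inl a) i 0 = (acol r g i.+1 a.+1)%:R.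
Proof. by rewrite vcol_Lambda_inl /acol ltnS eqSS; case: ifP. Qed.

Lemma vcol_inr_bits (a : 'I_m) i : vcol L (inr a) i 0 = (bcol m r g i.+1 a.+1)%:R.
Proof.
rewrite vcol_Lambda_inr /bcol ltnS eqSS; case: (leqP a r) => // _.
have -> : (a.+1 < m)%N = (a < m.-1)%N by lia.
by case: ifP.
Qed.

(** In the last hypothesis a set [R] of rows encodes a linear form that is 1
    on a_k and 0 on the other b_j, which separates a_k from the hyperplane
    they span. *)
Lemma char_of_simplex X k (T : seq nat) :
  (0 < k <= m)%N -> simplex_config m X ->
  uniq T -> size T = r.+1 -> all (fun l => 0 < l <= m)%N T -> k \notin T ->
  (forall i j, (0 < i < m)%N -> (0 < j <= m)%N -> j != k ->
     acol r g i j = X i j (+) X i k && (j \notin T)) ->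
  (forall i j, (0 < i < m)%N -> (0 < j <= m)%N ->
     bcol m r g i j = X i j (+) X i k && (j \in T)) ->
  (forall i, (0 < i < m)%N -> acol r g i k = X i k) \/
  r = 0%N /\ (exists2 R : seq nat, all (fun i => 0 < i < m)%N R &
    odd (count (fun i => acol r g i k) R) /\
    forall j, (0 < j <= m)%N -> j != k -> ~~ odd (count (fun i => bcol m r g i j) R)) ->
  L \in char_mxs m r.
Proof.
move=> hk hX uT sT T_le kT ha hb hak.
have k1m : (k.-1 < m)%N by lia.
have k1 : k.-1.+1 = k by lia.
have im (i : 'I_m.-1) : (0 < i.+1 < m)%N by have := ltn_ord i; lia.
have jm (j : 'I_m) : (0 < j.+1 <= m)%N by exact: ltn_ord.
pose x (j : 'I_m) : 'cV['F_2]_(m.-1) := \col_i (X i.+1 j.+1)%:R.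
apply/(bier_freeP _ hr).
apply: (@bier_free_simplex _ _ _ x _ _ (Ordinal k1m) [set j : 'I_m | j.+1 \in T]) => //.
- move=> S S0; apply: hX => i im'.
  have i1 : (i.-1 < m.-1)%N by lia.
  have /colP/(_ (Ordinal i1)) := S0; rewrite summxE mxE => S0i.
  rewrite -[RHS]S0i; apply: eq_bigr => j _; rewrite mxE /= prednK //; lia.
- by rewrite inE /= k1.
- by rewrite card_labels.
- move=> j jk; apply/colP=> i; rewrite /= vcol_inl_bits mxE mulmxnE !mxE /= k1 natr_mulrb.
  rewrite inE -F2_natr_addb ha //.
  by apply: contra jk => /eqP jk; apply/eqP/val_inj; rewrite /= -jk.
- move=> j; apply/colP=> i; rewrite /= vcol_inr_bits mxE mulmxnE !mxE /= k1 natr_mulrb.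
  by rewrite inE -F2_natr_addb hb.
case: hak => [hak | [r0 [R R_le [Rk Rj]]]]; [left | right; split=> //].
  by apply/colP=> i; rewrite /= vcol_inl_bits !mxE /= k1 hak.
move=> t kt /colP E.
have : \sum_(l <- R) ((acol r g l k)%:R + \sum_(j in t) (bcol m r g l j.+1)%:R) = 0 :> 'F_2.
  rewrite big_seq big1 // => l /(allP R_le) lm.
  have l1 : (l.-1 < m.-1)%N by lia.
  have := E (Ordinal l1); rewrite mxE [in X in _ = X]mxE summxE /= vcol_inl_bits /= k1.
  rewrite prednK; last by case/andP: lm.
  move=> El; rewrite -[RHS]El; congr (_ + _); apply: eq_bigr => j _.
  by rewrite /= vcol_inr_bits /= prednK //; case/andP: lm.
rewrite big_split exchange_big /= sum_F2_odd Rk big1 ?addr0 => [/eqP|j jt]; first by [].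
rewrite sum_F2_odd (negPf (Rj _ _ _)) //.
by apply: contraNneq kt => jk; rewrite (_ : Ordinal k1m = j) //; apply/val_inj; rewrite /= -jk.
Qed.
End FromSimplex.

(** * The listed matrices are characteristic *)

(** The standard simplex e_1, ..., e_(m-1), e_1 + ... + e_(m-1), moved by the
    change of basis that adds v to e_s; it is the simplex underlying B_v^s,
    whose column at barred s has 1 in row s and v in the bottom rows. *)
Definition skew_simplex m r s (v : nat -> bool) i j :=
  if j == s then (i == s) || (r.+1 < i)%N && v i
  else if j == m then (i <= r.+1)%N || ~~ v i else i == j.

Lemma sum_pred1 m (S : {set 'I_m}) (c : 'I_m) (b : bool) :
  \sum_(j in S) (b && (j == c))%:R = (b && (c \in S))%:R :> 'F_2.
Proof.
case: b => /=; last by rewrite big1.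
case: (boolP (c \in S)) => cS; last first.
  by rewrite big1 // => j jS; case: eqP cS => // <-; rewrite jS.
by rewrite (big_setD1 c cS) /= eqxx big1 ?addr0 // => j; rewrite !inE => /andP[/negbTE->].
Qed.

(** Row s of a zero sum over S says that s and m are both in S or both not;
    the row i then says the same of i and m. *)
Lemma skew_simplex_config m r s v : (r.+2 <= m)%N -> (0 < s <= r.+1)%N ->
  simplex_config m (skew_simplex m r s v).
Proof.
move=> hr hs S S0.
have s1 : (s.-1 < m)%N by lia.
have m1 : (m.-1 < m)%N by lia.
have rowE i (im : (0 < i < m)%N) (i1 : (i.-1 < m)%N) :
    let b := [&& i != s, r.+1 < i & v i]%N in
    (Ordinal i1 \in S) (+) b && (Ordinal s1 \in S) (+) ~~ b && (Ordinal m1 \in S) = false.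
  move=> b; apply/negbTE; apply/negP => H; have := S0 i im; move/eqP.
  rewrite (eq_bigr (fun j : 'I_m => ((true && (j == Ordinal i1))%:R
    + ((b && (j == Ordinal s1))%:R + (~~ b && (j == Ordinal m1))%:R)))); last first.
    move=> j _; have := ltn_ord j; rewrite -!F2_natr_addb -!val_eqE /= => jm.
    congr (nat_of_bool _)%:R; rewrite /skew_simplex /b.
    have -> : (j == i.-1 :> nat) = (i == j.+1) by lia.
    have -> : (j == s.-1 :> nat) = (j.+1 == s) by lia.
    have -> : (j == m.-1 :> nat) = (j.+1 == m) by lia.
    case: (eqVneq j.+1 s) => [->|_].
      have -> : (s == m) = false by lia.
      by rewrite andbF addbF andbT; case: (i == s).
    case: (eqVneq j.+1 m) => [->|_]; last by rewrite !andbF !addbF.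
    have -> : (i == m) = false by lia.
    rewrite andbF andbT /= leqNgt; case: (ltnP r.+1 i) => ri; last by rewrite andbF.
    by have -> : (i != s) by lia.
  by rewrite !big_split !sum_pred1 /= -!F2_natr_addb /= addbA H.
have sS : (Ordinal s1 \in S) = (Ordinal m1 \in S).
  have sm : (0 < s < m)%N by lia.
  by have := rowE s sm s1; rewrite eqxx /=; do 2 case: (_ \in S).
have allS (i : 'I_m) : (i \in S) = (Ordinal m1 \in S).
  have := ltn_ord i; case: (ltnP i m.-1) => im _; last first.
    by congr (_ \in S); apply: val_inj => /=; have := ltn_ord i; lia.
  have im' : (0 < i.+1 < m)%N by lia.
  have := rowE i.+1 im' (ltn_ord i); rewrite sS (_ : Ordinal _ = i); last exact: val_inj.
  by case: (i \in S); case: (Ordinal m1 \in S); case: (_ && _).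
case: (boolP (Ordinal m1 \in S)) => mS; [right | left]; apply/setP=> i;
  by rewrite allS inE ?mS // (negbTE mS).
Qed.

Local Ltac column_bits := rewrite /acol /bcol /skew_simplex; bits.

Lemma bitsA0_config m r : (r.+2 <= m)%N -> simplex_config m (bitsA0 m).
Proof.
move=> hr S S0; apply: (@skew_simplex_config m r 1 xpred0) => // i im.
rewrite -[RHS](S0 i im); apply: eq_bigr => j _.
by congr (nat_of_bool _)%:R; have := ltn_ord j; column_bits.
Qed.

Lemma bitsA0_char m r : (r.+2 <= m)%N ->
  Lambda r (bitmx m (bitsA0 m)) \in char_mxs m r.
Proof.
move=> hr; apply/(bier_freeP _ hr).
apply: (bier_free_doubled hr (x := fun j => \col_i (bitsA0 m i.+1 j.+1)%:R)) => [S S0|j|j].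
- apply: (bitsA0_config hr) => i im.
  have i1 : (i.-1 < m.-1)%N by lia.
  have /colP/(_ (Ordinal i1)) := S0; rewrite summxE mxE => S0i.
  by rewrite -[RHS]S0i; apply: eq_bigr => j _; rewrite mxE /= prednK //; lia.
- by apply/colP=> i; rewrite /= vcol_inl_bits !mxE; congr (nat_of_bool _)%:R;
    have := ltn_ord j; have := ltn_ord i; column_bits.
- by apply/colP=> i; rewrite /= vcol_inr_bits // !mxE; congr (nat_of_bool _)%:R;
    have := ltn_ord j; have := ltn_ord i; column_bits.
Qed.

(** Here k = m and T is the set of tops; the simplex is the standard one. *)
Lemma bitsA_char m r (v : nat -> bool) : (r.+2 <= m)%N ->
  (forall i, (r.+1 < i < m)%N -> v i) \/ r = 0%N ->
  Lambda r (bitmx m (bitsA m r v)) \in char_mxs m r.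
Proof.
move=> hr hv; pose X := bitsA0 m.
apply: (@char_of_simplex m r _ hr X m (iota 1 r.+1)); rewrite ?iota_uniq ?size_iota //.
- by rewrite leqnn andbT; lia.
- exact: (bitsA0_config hr).
- by apply/allP=> l; rewrite mem_iota; lia.
- by rewrite mem_iota; lia.
- by move=> i j im jm jk; rewrite mem_iota /X; column_bits.
- by move=> i j im jm; rewrite mem_iota /X; column_bits.
case: hv => [v1 | r0]; [left | right].
  by move=> i im; rewrite /X; have := v1 i; column_bits.
split=> //; exists [:: 1%N]; first by rewrite /=; lia.
by split=> [|j jm jk]; rewrite /= addn0 oddb; column_bits.
Qed.

(** Here k = s, and T consists of m and the tops other than s. *)
Lemma bitsB_char m r s (v : nat -> bool) : (r.+2 <= m)%N -> (0 < s <= r.+1)%N ->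
  (v =1 xpred0) \/ r = 0%N ->
  Lambda r (bitmx m (bitsB m r s v)) \in char_mxs m r.
Proof.
move=> hr hs hv; pose X := skew_simplex m r s v.
have s_iota : s \in iota 1 r.+1 by rewrite mem_iota; lia.
have memT j : (j \in m :: rem s (iota 1 r.+1)) = (j == m) || (j != s) && (0 < j <= r.+1)%N.
  by rewrite inE mem_rem_uniq ?iota_uniq // inE mem_iota.
apply: (@char_of_simplex m r _ hr X s (m :: rem s (iota 1 r.+1))).
- by lia.
- exact: skew_simplex_config.
- by rewrite cons_uniq rem_uniq ?iota_uniq // andbT mem_rem_uniq ?iota_uniq // inE mem_iota; lia.
- by rewrite -[LHS]/(size (rem s (iota 1 r.+1))).+1 size_rem // size_iota.
- by apply/allP=> l; rewrite memT; lia.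
- by rewrite memT; lia.
- by move=> i j im jm jk; rewrite memT /X; column_bits.
- by move=> i j im jm; rewrite memT /X; column_bits.
case: hv => [v0 | r0]; [left | right].
  by move=> i im; rewrite /X; have := v0 i; column_bits.
split=> //; exists [:: s]; first by rewrite /=; lia.
by split=> [|j jm jk]; rewrite /= addn0 oddb; column_bits.
Qed.

(** Here k = t and T is the set of tops; v only affects the column of a_t. *)
Lemma bitsC_char m r t (v : nat -> bool) : (r.+1 < t < m)%N ->
  (v =1 (fun i => i == t)) \/ r = 0%N ->
  Lambda r (bitmx m (bitsC m r t v)) \in char_mxs m r.
Proof.
move=> ht hv; have hr : (r.+2 <= m)%N by lia.
have Xt i : bitsA0 m i t = (i == t) by rewrite /bitsA0; lia.
have memT j : (0 < j <= m)%N -> (j \in iota 1 r.+1) = (j <= r.+1)%N.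
  by rewrite mem_iota; lia.
apply: (@char_of_simplex m r _ hr (bitsA0 m) t (iota 1 r.+1)); rewrite ?iota_uniq ?size_iota //.
- by lia.
- exact: (bitsA0_config hr).
- by apply/allP=> l; rewrite mem_iota; lia.
- by rewrite mem_iota; lia.
- move=> i j im jm jt; rewrite memT // Xt /acol bitsC_other //.
  have -> : (j <= m)%N by lia.
  case: (leqP j r.+1) => //= jr; rewrite andbF addbF /bitsA0; lia.
- move=> i j im jm; rewrite memT // Xt /bcol.
  case: (leqP j r.+1) => jr; first by rewrite bitsC_other; [congr (_ (+) _ && _) |]; lia.
  rewrite andbF addbF; case: (ltnP j m) => jm'; first by rewrite /bitsA0; lia.
  by rewrite bitsC_other /bitsA0; lia.
case: hv => [v1 | r0]; [left | right].
  by move=> i im; rewrite /acol Xt bitsC_col //; have := v1 i; have := v1 t; column_bits.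
split=> //; exists [:: 1%N; t]; first by rewrite /=; lia.
have tr : (t <= r.+1)%N = false by lia.
split=> [|j jm jk]; rewrite /= addn0 oddD !oddb.
  by rewrite /acol tr !bitsC_col // tr; case: (v t).
rewrite /bcol; case: (leqP j r.+1) => jr; first by rewrite !bitsC_other // /bitsA0; lia.
case: (ltnP j m) => jm'; first by lia.
by rewrite !bitsC_other /bitsA0; lia.
Qed.

(** * The listed matrices as bit matrices *)

Definition vbits m r (v : 'rV['F_2]_(m - r - 2)) i : bool := vcoord r v i != 0.

Definition bitvec m r (f : nat -> bool) : 'rV['F_2]_(m - r - 2) :=
  \row_k (f (k + r.+2)%N)%:R.

Lemma vcoord_bitvec m r f i : (r.+1 < i < m)%N -> vcoord r (bitvec m r f) i = (f i)%:R.
Proof.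
move=> im; rewrite /vcoord; have -> : (r.+2 <= i)%N by lia.
case: insubP => [k _ ki | ]; last by rewrite -leqNgt; lia.
by rewrite mxE ki subnK //; lia.
Qed.

Lemma vbits_bitvec m r f i : (r.+1 < i < m)%N -> vbits (bitvec m r f) i = f i.
Proof. by move=> im; rewrite /vbits vcoord_bitvec //; case: (f i). Qed.

Lemma vbits_inj m r (v w : 'rV['F_2]_(m - r - 2)) :
  (forall i, (r.+1 < i < m)%N -> vbits v i = vbits w i) -> v = w.
Proof.
move=> vw; apply/rowP=> k.
have E (u : 'rV['F_2]_(m - r - 2)) : u 0 k = vcoord r u (k + r.+2).
  by rewrite /vcoord leq_addl addnK valK.
rewrite !E [LHS]F2_natE [RHS]F2_natE; congr (nat_of_bool _)%:R; apply: vw.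
by have := ltn_ord k; lia.
Qed.

Lemma agree_bitmx m (g g' : nat -> nat -> bool) : agree_entries m g g' -> bitmx m g = bitmx m g'.
Proof.
by move=> gg; apply/matrixP=> i j; rewrite !mxE gg //; have := ltn_ord i; have := ltn_ord j; lia.
Qed.

Lemma bitmx_agree m (g g' : nat -> nat -> bool) : bitmx m g = bitmx m g' -> agree_entries m g g'.
Proof.
move=> /matrixP gg i j im jm.
have i1 : (i.-1 < m.-1)%N by lia.
have j1 : (j.-1 < m.+1)%N by lia.
have := gg (Ordinal i1) (Ordinal j1); rewrite !mxE /= !prednK; try lia.
by case: (g i j); case: (g' i j) => // /eqP.
Qed.

Lemma bitmx_surj m (A : 'M['F_2]_(m.-1, m.+1)) : exists g : nat -> nat -> bool, A = bitmx m g.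
Proof.
exists (fun i j => if insub i.-1 is Some i' then if insub j.-1 is Some j' then A i' j' != 0
                   else false else false).
by apply/matrixP=> i j; rewrite !mxE /= !valK -F2_natE.
Qed.

Lemma mxA0_bits m : (0 < m)%N -> mxA0 m = bitmx m (bitsA0 m).
Proof.
move=> m0; apply/matrixP=> i j; rewrite !mxE /bitsA0 /delta.
rewrite (_ : (j.+1 <= m.-1)%N = (j.+1 < m)%N); last by lia.
by case: (ltnP j.+1 m).
Qed.

Lemma mxA_bits m r (v : 'rV['F_2]_(m - r - 2)) :
  (0 < m)%N -> mxA r v = bitmx m (bitsA m r (vbits v)).
Proof.
move=> m0; apply/matrixP=> i j; rewrite !mxE /bitsA /delta.
rewrite (_ : (j.+1 <= m.-1)%N = (j.+1 < m)%N); last by lia.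
case: ifP => _; first by case: (_ == _); apply/eqP.
case: ifP => _ //; case: ifP => _ //=; exact: F2_natE.
Qed.

Lemma mxB_bits m r s (v : 'rV['F_2]_(m - r - 2)) :
  (0 < m)%N -> mxB r s v = bitmx m (bitsB m r s (vbits v)).
Proof.
move=> m0; apply/matrixP=> i j; rewrite !mxE /bitsB /delta [vcoord _ _ _]F2_natE -/(vbits v _).
rewrite (_ : (j.+1 <= m.-1)%N = (j.+1 < m)%N); last by lia.
case: ifP => _; first by case: ifP.
case: ifP => _; first by case: (ltnP j.+1 m).
case: ifP => _; first by rewrite F2_natr_addb.
by case: ifP => _ //; case: (vbits v _); apply/eqP.
Qed.

Lemma mxC_bits m r t (v : 'rV['F_2]_(m - r - 2)) :
  (0 < m)%N -> mxC r t v = bitmx m (bitsC m r t (vbits v)).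
Proof.
move=> m0; rewrite /mxC mxA0_bits //; apply/matrixP=> i j.
rewrite !mxE /bitsC !F2_natr_addb; congr (_ + _ + _); last by case: (_ && _).
case: (_ == t) => //=; rewrite [vcoord _ _ t]F2_natE [vcoord _ _ i.+1]F2_natE -!/(vbits v _).
by case: ifP => _ //; case: (vbits v t); apply/eqP.
Qed.

(** One family for all the listed matrices: the label [k] distinguishes them,
    and [k = 0] stands for A_0. *)
Definition family_bits m r k v :=
  if k == 0%N then bitsA0 m else if k == m then bitsA m r v
  else if (k <= r.+1)%N then bitsB m r k v else bitsC m r k v.

(** The entry (1, 1) vanishes only for k = m; the column m + 1 has a zero only
    for a top k, in row k; for a bottom k the column m has its only zero in row k,
    and A_0 has none of these zeros.  Given k, the vector v is read off the column m, or
    the column k if k is a bottom. *)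
Lemma family_bits_inj m r k k' v v' : (r.+2 <= m)%N -> (k <= m)%N -> (k' <= m)%N ->
  agree_entries m (family_bits m r k v) (family_bits m r k' v') ->
  k = k' /\ ((0 < k)%N -> forall i, (r.+1 < i < m)%N -> v i = v' i).
Proof.
move=> hr km km' E.
have diag q w : (q <= m)%N -> family_bits m r q w 1 1 = (q != m).
  rewrite /family_bits => qm; case: eqP => [->|q0]; first by rewrite /bitsA0; lia.
  case: eqP => [_|qm']; first by rewrite /bitsA; case: ifP; lia.
  case: leqP => qr; last by rewrite bitsC_other /bitsA0; lia.
  by rewrite /bitsB; case: eqP => _; rewrite /= ?orbT //; lia.
have last_col q w i : (q <= m)%N -> (0 < i < m)%N ->
    family_bits m r q w i m.+1 = ~~ ((q == i) && (q <= r.+1)%N).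
  rewrite /family_bits => qm im; case: eqP => [->|q0]; first by rewrite /bitsA0; lia.
  case: eqP => [->|qm']; first by rewrite /bitsA; do ?[case: ifP => ?]; lia.
  case: leqP => qr; last by rewrite bitsC_other /bitsA0; lia.
  rewrite /bitsB; do ?[case: ifP => ?]; lia.
have mth_col q w i : (q < m)%N -> (r.+1 < q)%N || (q == 0%N) -> (0 < i < m)%N ->
    family_bits m r q w i m = (q != i).
  rewrite /family_bits => qm qr im; case: eqP => [->|q0]; first by rewrite /bitsA0; lia.
  rewrite ifN; last by lia.
  rewrite ifN; last by lia.
  by rewrite bitsC_other /bitsA0; lia.
have km_eq : (k == m) = (k' == m).
  have := E 1%N 1%N; rewrite !diag // => /(_ _ _) E1.
  apply/negb_inj/E1; lia.
have top_eq i : (0 < i < m)%N -> (k == i) && (k <= r.+1)%N = (k' == i) && (k' <= r.+1)%N.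
  move=> im; have := E i m.+1 im; rewrite !last_col // => E1; apply/negb_inj/E1; lia.
have kk' : k = k'.
  case: (eqVneq k m) km_eq => [->|kNm] /esym; first by move/eqP.
  move/negbT => k'Nm.
  case: (posnP k) => [k0|k_gt0].
    case: (posnP k') => [->//|k'_gt0].
    have k'i : (0 < k' < m)%N by lia.
    have := top_eq k' k'i; rewrite eqxx k0 (_ : (0 == k')%N = false) /=; last by lia.
    move=> /esym/negbT; rewrite -ltnNge => rk'.
    by have := E k' m k'i; rewrite !mth_col ?k0 ?eqxx ?rk' ?orbT //; lia.
  have ki : (0 < k < m)%N by lia.
  case: (leqP k r.+1) => kr.
    by have := top_eq k ki; rewrite eqxx kr => /esym/andP[/eqP].
  have k'r : (r.+1 < k')%N || (k' == 0%N).
    rewrite ltnNge orbC; apply/norP => -[k'0]; rewrite negbK => k'r.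
    have k'i : (0 < k' < m)%N by lia.
    by have := top_eq k' k'i; rewrite eqxx k'r; lia.
  by have := E k m ki; rewrite (mth_col k) ?(mth_col k') ?kr //; lia.
split=> // k_gt0 i im; move: E; rewrite -kk' /family_bits => E.
have i0 : (0 < i < m)%N by lia.
have k0 : (k == 0%N) = false by lia.
move: E; rewrite k0.
case: eqP => [_ | kNm].
  move=> /(_ i m i0); rewrite /bitsA ltnn eqxx.
  have -> : (i <= r.+1)%N = false by lia.
  by rewrite /=; apply; lia.
case: leqP => kr.
  move=> /(_ i m i0); rewrite /bitsB ltnn eqxx.
  have -> : (i == k) = false by lia.
  have -> : (i <= r.+1)%N = false by lia.
  by move=> E; apply/negb_inj/E; lia.
have kt : (r.+1 < k < m)%N by lia.
move=> /(_ i k i0); rewrite !bitsC_col //.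
have -> : (i <= r.+1)%N = false by lia.
by apply; lia.
Qed.

(** * Counting *)

Lemma family_bits_ext m r k (v w : nat -> bool) : (k <= m)%N ->
  (forall i, (r.+1 < i < m)%N -> v i = w i) ->
  agree_entries m (family_bits m r k v) (family_bits m r k w).
Proof.
move=> km vw i j im jm; rewrite /family_bits.
case: eqP => [//|k0]; case: eqP => [kEm|kNm].
  rewrite /bitsA; case: ifP => // _; case: ifP => // _.
  by case: (leqP i r.+1) => //= ir; apply: vw; lia.
case: (leqP k r.+1) => kr.
  rewrite /bitsB; case: eqP => // _; case: (leqP i r.+1) => // ir.
  by rewrite vw //; lia.
rewrite /bitsC; congr (_ (+) (_ && _) (+) _); rewrite vw; last by lia.
by case: (leqP i r.+1) => // ir; apply: vw; lia.
Qed.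

Definition family_mx m r (o : option ('I_m * 'rV['F_2]_(m - r - 2))) :
    'M['F_2]_(m.-1, m.+1) :=
  if o is Some (k, v) then
    if k.+1 == m then mxA r v
    else if (k <= r)%N then mxB r k.+1 v else mxC r k.+1 v
  else mxA0 m.

Lemma family_mx_bits m r o : (0 < m)%N ->
  @family_mx m r o
  = bitmx m (if o is Some (k, v) then family_bits m r k.+1 (vbits v) else bitsA0 m).
Proof.
move=> m0; case: o => [[k v]|] /=; last exact: mxA0_bits.
rewrite /family_bits /= ltnS; case: eqP => _; first exact: mxA_bits.
by case: ifP => _; [exact: mxB_bits | exact: mxC_bits].
Qed.

Lemma family_mx_inj m r : (r.+2 <= m)%N -> injective (@family_mx m r).
Proof.
move=> hr o o'; rewrite !family_mx_bits ?(leq_trans _ hr) // => /bitmx_agree.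
have F0 : bitsA0 m = family_bits m r 0 xpred0 by [].
case: o => [[k v]|]; case: o' => [[k' v']|] //.
- move=> /(family_bits_inj hr (ltn_ord k) (ltn_ord k'))[[kk'] vv'].
  have {}kk' := val_inj kk'; congr (Some (_, _)) => //.
  by apply: vbits_inj; apply: vv'.
- by rewrite F0 => /(family_bits_inj hr (ltn_ord k) (leq0n m))[].
by rewrite F0 => /(family_bits_inj hr (leq0n m) (ltn_ord k'))[].
Qed.

(** The only v that is allowed for the label [k] when r > 0. *)
Definition rigid_vec m r (k : 'I_m) : 'rV['F_2]_(m - r - 2) :=
  if k.+1 == m then const_mx 1
  else if (k <= r)%N then const_mx 0 else bitvec m r (fun i => i == k.+1).

Lemma vbits_const m r (b : bool) i : (r.+1 < i < m)%N ->
  vbits (const_mx b%:R : 'rV_(m - r - 2)) i = b.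
Proof.
move=> im; rewrite -[RHS](@vbits_bitvec m r (fun=> b) i im); congr (vbits _ _).
by apply/rowP=> k; rewrite !mxE.
Qed.

Lemma family_mx_char m r (k : 'I_m) v : (r.+2 <= m)%N -> v = rigid_vec r k \/ r = 0%N ->
  Lambda r (family_mx (Some (k, v))) \in char_mxs m r.
Proof.
move=> hr hv; have m0 : (0 < m)%N by lia.
have km := ltn_ord k; move: hv; rewrite /= /rigid_vec; case: eqP => [kEm|kNm] hv.
  rewrite mxA_bits //; apply: bitsA_char => //; case: hv => [->|]; [left=> i im | by right].
  exact: (vbits_const true).
case: leqP hv => kr hv.
  rewrite mxB_bits //; case: hv => [->|r0]; last by apply: bitsB_char => //; right.
  rewrite (agree_bitmx (g' := bitsB m r k.+1 xpred0)).
    by apply: bitsB_char => //; left.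
  have := @family_bits_ext m r k.+1 (vbits (const_mx 0 : 'rV_(m - r - 2))) xpred0 km.
  rewrite /family_bits /= ltnS kr; case: eqP => // _; apply=> i im.
  exact: (vbits_const false).
rewrite mxC_bits //.
have kt : (r.+1 < k.+1 < m)%N by lia.
case: hv => [->|r0]; last by apply: bitsC_char => //; right.
rewrite (agree_bitmx (g' := bitsC m r k.+1 (fun i => i == k.+1))).
  by apply: bitsC_char => //; left.
have := @family_bits_ext m r k.+1 (vbits (bitvec m r (fun i => i == k.+1)))
          (fun i => i == k.+1) km.
rewrite /family_bits /= ltnS leqNgt kr; case: eqP => // _; apply=> i im.
exact: vbits_bitvec.
Qed.

Lemma mxA0_char m r : (r.+2 <= m)%N -> Lambda r (mxA0 m) \in char_mxs m r.
Proof. by move=> hr; rewrite mxA0_bits; [exact: bitsA0_char | lia]. Qed.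

Lemma char_family0 m (A : 'M['F_2]_(m.-1, m.+1)) : (3 < m)%N ->
  Lambda 0 A \in char_mxs m 0 -> exists o, A = @family_mx m 0 o.
Proof.
move=> hm chA; have hr : (2 <= m)%N by lia.
have [g EA] := bitmx_surj A; subst A.
have step k (v : nat -> bool) (k1 : (k < m)%N) : agree_entries m g (family_bits m 0 k.+1 v) ->
    exists o, bitmx m g = @family_mx m 0 o.
  move=> gv; exists (Some (Ordinal k1, bitvec m 0 v)).
  rewrite family_mx_bits /=; last by lia.
  rewrite (agree_bitmx gv); apply: agree_bitmx; apply: family_bits_ext => // i im.
  by rewrite vbits_bitvec.
have [] := classify0 hr chA erefl hm.
- by move=> /agree_bitmx ->; exists None; rewrite /= mxA0_bits //; lia.
- case=> v gv; have m1 : (m.-1 < m)%N by lia.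
  have mm : m.-1.+1 = m by lia.
  by apply: (step _ v m1); rewrite /family_bits mm eqxx; case: eqP => //; lia.
- case=> v gv; have m1 : (0 < m)%N by lia.
  by apply: (step _ v m1); rewrite /family_bits /=; case: eqP => //; lia.
case=> t; rewrite mem_bots => tm [v gv].
have m1 : (t.-1 < m)%N by lia.
have tt : t.-1.+1 = t by lia.
have tr : (t <= 1)%N = false by lia.
have tm' : (t == m) = false by lia.
by apply: (step _ v m1); rewrite /family_bits tt tm' tr; case: eqP => //; lia.
Qed.

Lemma char_family_pos m r (A : 'M['F_2]_(m.-1, m.+1)) : (0 < r)%N -> (r.+3 < m)%N ->
  Lambda r A \in char_mxs m r ->
  exists o, A = @family_mx m r (omap (fun k => (k, rigid_vec r k)) o).
Proof.
move=> r0 hm chA; have hr : (r.+2 <= m)%N by lia.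
have [g EA] := bitmx_surj A; subst A.
have step k (v : nat -> bool) (k1 : (k < m)%N) : agree_entries m g (family_bits m r k.+1 v) ->
    (forall i, (r.+1 < i < m)%N -> vbits (rigid_vec r (Ordinal k1)) i = v i) ->
    exists o, bitmx m g = @family_mx m r (omap (fun k => (k, rigid_vec r k)) o).
  move=> gv vE; exists (Some (Ordinal k1)).
  rewrite family_mx_bits /=; last by lia.
  by rewrite (agree_bitmx gv); apply: agree_bitmx; apply: family_bits_ext => // i /vE->.
have [] := classify_pos hr chA r0 hm.
- by move=> /agree_bitmx ->; exists None; rewrite /= mxA0_bits //; lia.
- move=> gv; have m1 : (m.-1 < m)%N by lia.
  have mm : m.-1.+1 = m by lia.
  apply: (step _ xpredT m1) => [|i im]; first by rewrite /family_bits mm eqxx; case: eqP => //; lia.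
  by rewrite /rigid_vec /= mm eqxx (vbits_const true).
- case=> s; rewrite mem_tops => sr gv; have m1 : (s.-1 < m)%N by lia.
  have ss : s.-1.+1 = s by lia.
  have sr' : (s.-1 <= r)%N by lia.
  have sm : (s == m) = false by lia.
  apply: (step _ xpred0 m1) => [|i im].
    by rewrite /family_bits ss sm; case: eqP => [|_]; [lia | case/andP: sr => _ ->].
  by rewrite /rigid_vec /= ss sm sr' (vbits_const false).
case=> t; rewrite mem_bots => tm gv; have m1 : (t.-1 < m)%N by lia.
have tt : t.-1.+1 = t by lia.
have tr : (t.-1 <= r)%N = false by lia.
have tr' : (t <= r.+1)%N = false by lia.
have tm' : (t == m) = false by lia.
apply: (step _ (fun i => i == t) m1) => [|i im].
  by rewrite /family_bits tt tm' tr'; case: eqP => //; lia.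
by rewrite /rigid_vec /= tt tm' tr vbits_bitvec.
Qed.

Theorem theorem3p3 (m r : nat) (hm : (4 <= m)%N) (hr : (r <= (m - 3) %/ 2)%N) :
  [/\ #|DJ_classes m r| = (if r == 0%N then 1 + m * 2 ^ (m - 2) else 1 + m)%N,
      r = 0%N ->
      forall L : 'M['F_2]_(m.-1, m + m), L \in char_mxs m r ->
      exists A : 'M['F_2]_(m.-1, m.+1),
        DJ_equiv L (Lambda r A) /\
        [\/ A = mxA0 m,
            exists v : 'rV['F_2]_(m - r - 2), A = mxA r v,
            exists v : 'rV['F_2]_(m - r - 2), A = mxB r 1%N v
          | exists t : nat, exists v : 'rV['F_2]_(m - r - 2),
              (r + 2 <= t <= m - 1)%N /\ A = mxC r t v]
    & (0 < r)%N ->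
      forall L : 'M['F_2]_(m.-1, m + m), L \in char_mxs m r ->
      exists A : 'M['F_2]_(m.-1, m.+1),
        DJ_equiv L (Lambda r A) /\
        [\/ A = mxA0 m,
            A = mxA r (const_mx 1),
            exists s : nat, (1 <= s <= r + 1)%N /\
              A = mxB r s (const_mx 0)
          | exists t : nat, exists v : 'rV['F_2]_(m - r - 2),
              [/\ (r + 2 <= t <= m - 1)%N,
                  vcoord r v t = 1,
                  forall i : nat, (r + 2 <= i <= m - 1)%N -> i <> t ->
                    vcoord r v i = 0
                & A = mxC r t v]]].
Proof.
have hr2 : (r.+2 <= m)%N by lia.
split.
- rewrite card_DJ_classes //; case: eqP => [r0 | /eqP r0].
    subst r; transitivity #|[set family_mx o | o : option ('I_m * 'rV['F_2]_(m - 0 - 2))]|.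
      apply: eq_card => A; rewrite inE; apply/idP/imsetP => [chA | [o _ ->]].
        by have [o ->] := char_family0 hm chA; exists o.
      by case: o => [[k v]|]; [apply: family_mx_char => //; right | exact: mxA0_char].
    rewrite card_imset; last exact: family_mx_inj.
    by rewrite card_option card_prod card_ord card_mx card_ord mul1n subn0 add1n.
  have r_gt0 : (0 < r)%N by rewrite lt0n.
  pose F o := @family_mx m r (omap (fun k : 'I_m => (k, rigid_vec r k)) o).
  transitivity #|[set F o | o : option 'I_m]|.
    apply: eq_card => A; rewrite inE; apply/idP/imsetP => [chA | [o _ ->]].
      by have [|o ->] := char_family_pos r_gt0 _ chA; [lia | exists o].
    by case: o => [k|]; [apply: family_mx_char => //; left | exact: mxA0_char].
  rewrite card_imset ?card_option ?card_ord // => o o' /(family_mx_inj hr2).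
  by case: o o' => [k|] [k'|] //= [->].
- move=> r0 L /(DJ_normal_form hr2)[A chA LA]; exists A; split=> //.
  subst r; have [o ->] := char_family0 hm chA.
  case: o => [[k v]|] /=; last by constructor 1.
  have km := ltn_ord k; case: eqP => kEm; first by constructor 2; exists v.
  case: leqP => kr; [constructor 3 | constructor 4].
    by exists v; rewrite (_ : k.+1 = 1%N) //; lia.
  by exists k.+1, v; split=> //; lia.
move=> r_gt0 L /(DJ_normal_form hr2)[A chA LA]; exists A; split=> //.
have [|o ->] := char_family_pos r_gt0 _ chA; first by lia.
case: o => [k|] /=; last by constructor 1.
rewrite /rigid_vec; have km := ltn_ord k; case: eqP => kEm; first by constructor 2.
case: leqP => kr; [constructor 3 | constructor 4].
  by exists k.+1; split=> //; lia.
exists k.+1, (bitvec m r (fun i => i == k.+1)); split=> //; first by lia.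
  by rewrite vcoord_bitvec ?eqxx //; lia.
by move=> i im /eqP/negbTE ik; rewrite vcoord_bitvec ?ik //; lia.
Qed.
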